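(* Let $n\in\{1,2,3,\ldots\}\cup\{\infty\}$. Then every 2-local derivation on the Lie algebra $W_n^+$ is a derivation of $W_n^+$, and every 2-local derivation on the Lie algebra $W_n^{++}$ is a derivation of $W_n^{++}$.
   Context: All algebras are over $\mathbb{C}$. A derivation on a Lie algebra $L$ is a linear map $D:L\to L$ with $D([x,y])=[D(x),y]+[x,D(y)]$ for all $x,y\in L$. A 2-local derivation on $L$ is a map $\Delta:L\to L$ (not necessarily linear) such that for every $x,y\in L$ there exists a derivation $D_{x,y}:L\to L$ with $\Delta(x)=D_{x,y}(x)$ and $\Delta(y)=D_{x,y}(y)$. $\mathbb{Z}_+$ is the set of non-negative integers; $\mathbb{Z}_+^\infty$ is the set of sequences $(\alpha_1,\alpha_2,\ldots)$ in $\mathbb{Z}_+$ with only finitely many nonzero entries. Write $d_i=t_i\frac{\partial}{\partial t_i}$, $t^\alpha=\prod_i t_i^{\alpha_i}$, and let $\mathfrak{h}_n$ be the $\mathbb{C}$-span of $d_1,\ldots,d_n$ for $n$ finite, and $\mathfrak{h}_\infty$ the $\mathbb{C}$-span (finite linear combinations) of all $d_i$, $i\ge1$. The bracket is $[t^\alpha d_i,t^\beta d_j]=\beta_i t^{\alpha+\beta}d_j-\alpha_j t^{\alpha+\beta}d_i$. For finite $n$, $W_n^+=\mathrm{Der}(\mathbb{C}[t_1,\ldots,t_n])=\sum_{\alpha\in\mathbb{Z}_+^n}t^\alpha\mathfrak{h}_n+\sum_{i=1}^n\mathbb{C}t_i^{-1}d_i$ (here $t_i^{-1}d_i=\frac{\partial}{\partial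 t_i}$; the right-hand sum is to be read as the Lie algebra of all derivations $\sum_i f_i\frac{\partial}{\partial t_i}$ with $f_i\in\mathbb{C}[t_1,\ldots,t_n]$), and $W_n^{++}=\sum_{\alpha\in\mathbb{Z}_+^n}t^\alpha\mathfrak{h}_n$, a Lie subalgebra of $W_n^+$. For $n=\infty$, $W_\infty^+$ is the Lie algebra of derivations of $\mathbb{C}[t_1,t_2,\ldots]$ of the form of a finite sum $\sum_i f_i\frac{\partial}{\partial t_i}$ with $f_i\in\mathbb{C}[t_1,t_2,\ldots]$ (i.e. $W_\infty^+=\bigcup_{n}W_n^+$), and $W_\infty^{++}=\sum_{\alpha\in\mathbb{Z}_+^\infty}t^\alpha\mathfrak{h}_\infty$ (finite sums), a Lie subalgebra of $W_\infty^+$. *)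

(* Defs.v *)
From HB Require Import structures.
From mathcomp Require Import all_boot all_order all_algebra finmap zify ring.
From mathcomp Require Import boolp.
From mathcomp.multinomials Require Import monalg.

Set Implicit Arguments.
Unset Strict Implicit.
Unset Printing Implicit Defensive.

Import GRing.Theory.
Local Open Scope fset_scope.
Local Open Scope ring_scope.

HB.mixin Record isLieAlgebra (K : fieldType) L of GRing.Lmodule K L := {
  lie : L -> L -> L;
  lie_linearl : forall y, linear (lie^~ y);
  lie_linearr : forall x, linear (lie x);
  liexx : forall x, lie x x = 0;
  lie_jacobi : forall x y z,
    lie x (lie y z) + lie y (lie z x) + lie z (lie x y) = 0
}.

#[short(type="lieAlgType")]
HB.structure Definition LieAlgebra (K : fieldType) :=
  {L of isLieAlgebra K L & GRing.Lmodule K L}.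

Section LieDerivations.
Variables (K : fieldType) (L : lieAlgType K).

Definition is_derivation (D : L -> L) : Prop :=
  linear D /\ forall x y, D (lie x y) = lie (D x) y + lie x (D y).

Definition is_2local_derivation (Delta : L -> L) : Prop :=
  forall x y, exists D : L -> L,
    [/\ is_derivation D, Delta x = D x & Delta y = D y].

End LieDerivations.

(* Finitely supported exponents alpha : I -> nat, where I indexes the variables.
   This is a wrapper of monalg's {cmonom I}, whose structures of eqType and
   choiceType are replaced by opaque ones: rewriting in {malg _[{cmonom I}]}
   otherwise often diverges, by unfolding the computation of equality. Some of
   the operations below are locked for the same reason. *)
Section Exponents.
Variable I : choiceType.

Record mexp : predArgType := MExp { mexp_val :> {cmonom I} }.

HB.instance Definition _ := gen_eqMixin mexp.
HB.instance Definition _ := gen_choiceMixin mexp.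

Implicit Types (a b c : mexp) (i j : I).

Lemma mexpP a b : (forall i, a i = b i) <-> a = b.
Proof.
split=> [|-> //]; case: a b => [a] [b] /= eq_ab.
by congr MExp; apply/eqP/cmP.
Qed.

Definition mexp_one := MExp (onecm I).
Definition mexp_mul a b := MExp (mulcm a b).
Definition mexpU i := MExp (ucm i).
(* truncated subtraction: the exponent is left unchanged if a i = 0 *)
Definition mexp_pred i a := MExp (divcm a (ucm i)).

Lemma mexp_mulA : associative mexp_mul.
Proof. by move=> a b c; congr MExp; rewrite mulcmA. Qed.

Lemma mexp_mulC : commutative mexp_mul.
Proof. by move=> a b; congr MExp; rewrite mulcmC. Qed.

Lemma mexp_mul1 : left_id mexp_one mexp_mul.
Proof. by move=> a; apply/mexpP => i; rewrite mulcmE onecmE. Qed.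

Lemma mexp_mulr1 : right_id mexp_one mexp_mul.
Proof. by move=> a; rewrite mexp_mulC mexp_mul1. Qed.

Lemma mexp_mul_eq1 a b : mexp_mul a b = mexp_one -> a = mexp_one /\ b = mexp_one.
Proof.
case: a b => [a] [b]; rewrite /mexp_mul /mexp_one /= => -[/mulcm_eq0].
by case=> -> ->.
Qed.

HB.instance Definition _ :=
  Choice_isMonomialDef.Build mexp mexp_mulA mexp_mul1 mexp_mulr1 mexp_mul_eq1.
HB.instance Definition _ := MonomialDef_isConomialDef.Build mexp mexp_mulC.

Lemma mexp1E i : (mone : mexp) i = 0%N.
Proof. exact: onecmE. Qed.

Lemma mexpME a b i : (mmul a b : mexp) i = (a i + b i)%N.
Proof. exact: mulcmE. Qed.

Lemma mexpUE i j : mexpU i j = (i == j).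
Proof. exact: ucmE. Qed.

Lemma mexp_predE i a j : mexp_pred i a j = (a j - (i == j))%N.
Proof. by rewrite /mexp_pred divcmE ucmE. Qed.

Lemma mexp_predM i a b : (0 < a i)%N ->
  mexp_pred i (mmul a b) = mmul (mexp_pred i a) b.
Proof.
move=> ai; apply/mexpP => j; rewrite !(mexp_predE, mexpME).
by case: eqP => [<-|_]; lia.
Qed.

Lemma mexp_predK i a : (0 < a i)%N -> mmul (mexpU i) (mexp_pred i a) = a.
Proof.
move=> ai; apply/mexpP => j; rewrite mexpME mexp_predE mexpUE.
by case: eqP => [<-|_]; lia.
Qed.

Lemma mexp_predU i : mexp_pred i (mexpU i) = mone.
Proof.
by apply/mexpP => j; rewrite mexp_predE mexpUE mexp1E subnn.
Qed.

Lemma mexp_ind (Q : mexp -> Prop) : Q mone ->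
  (forall i a, Q a -> Q (mmul (mexpU i) a)) -> forall a, Q a.
Proof.
move=> Q1 QU a; move dn : (mdeg a) => n.
elim: n a dn => [|n IHn] a dn.
  suff -> : a = mone by [].
  by apply/mexpP => i; rewrite mexp1E (mdeg_eq0I dn) cm1.
have [i +] : exists i, i \in finsupp a.
  case: (fset_0Vmem (finsupp a)) => [a0|[i ai]]; last by exists i.
  by move: dn; rewrite mdegE a0 big_seq_fset0.
rewrite -cmE_neq0 -lt0n => ai; rewrite -(mexp_predK ai); apply/QU/IHn.
suff : mdeg a = (mdeg (ucm i) + mdeg (mexp_pred i a))%N by rewrite mdegU dn => -[].
by rewrite -mdegM; congr mdeg; rewrite -{1}(mexp_predK ai).
Qed.

End Exponents.

Arguments mexpU {I} i.

(* The polynomial algebra K[t_i : i in I]; t^alpha is << alpha >>. *)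
Notation polyIn K I := {malg K[mexp I]}.

HB.lock
Definition pderiv (K : fieldType) (I : choiceType) (i : I) (p : polyIn K I) :
    polyIn K I :=
  \sum_(a <- msupp p) << p@_a *+ a i *g mexp_pred i a >>.

Section Polynomials.
Variables (K : fieldType) (I : choiceType).

Local Notation P := (polyIn K I).
Implicit Types (p q : P) (a b : mexp I) (i j : I) (D : P -> P).

Definition tvar i : P := << mexpU i >>.

Definition is_poly_derivation D : Prop :=
  linear D /\ forall p q, D (p * q) = D p * q + p * D q.

Lemma malgZU c x a : c *: << x *g a >> = << c * x *g a >> :> P.
Proof. by apply/malgP => k; rewrite mcoeffZ !mcoeffU mulrnAr. Qed.

Lemma malgMU x a y b :
  << x *g a >> * << y *g b >> = << x * y *g mmul a b >> :> P.
Proof. exact: fgmulUU. Qed.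

Lemma pderivEw i p (d : {fset mexp I}) : msupp p `<=` d ->
  pderiv i p = \sum_(a <- d) << p@_a *+ a i *g mexp_pred i a >>.
Proof.
move=> le; rewrite pderiv.unlock (big_fset_incl _ le) // => a _ /mcoeff_outdom ->.
by rewrite mul0rn monalgU0.
Qed.

Lemma pderiv_monom i c a :
  pderiv i (<< c *g a >> : P) = << c *+ a i *g mexp_pred i a >>.
Proof. by rewrite (pderivEw _ msuppU_le) big_seq_fset1 mcoeffUU. Qed.

Lemma pderiv_is_linear i : linear (@pderiv K I i).
Proof.
move=> c p q; pose d := msupp p `|` msupp q.
have lep : msupp p `<=` d by apply: fsubsetUl.
have leq : msupp q `<=` d by apply: fsubsetUr.
have leD : msupp (c *: p + q) `<=` d.
  apply: fsubset_trans (msuppD_le _ _) _; apply: fsetUSS => //.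
  exact: msuppZ_le.
rewrite (pderivEw _ leD) (pderivEw _ lep) (pderivEw _ leq).
rewrite scaler_sumr -big_split /=; apply: eq_bigr => a _.
by rewrite mcoeffD mcoeffZ mulrnDl monalgUD malgZU mulrnAr.
Qed.

HB.instance Definition _ i :=
  GRing.isLinear.Build K P P *:%R (@pderiv K I i) (pderiv_is_linear i).

Lemma pderivM i p q : pderiv i (p * q) = pderiv i p * q + p * pderiv i q.
Proof.
have monom c a c' b : let f : P := << c *g a >> in let g : P := << c' *g b >> in
    pderiv i (f * g) = pderiv i f * g + f * pderiv i g.
  rewrite /= malgMU !pderiv_monom !malgMU mexpME mulrnDr monalgUD.
  rewrite mulrnAl mulrnAr; congr (_ + _).
    have [->|ai] := posnP (a i); first by rewrite !mulr0n !monalgU0.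
    by rewrite mexp_predM.
  have [->|bi] := posnP (b i); first by rewrite !mulr0n !monalgU0.
  by rewrite mulmC mexp_predM // mulmC.
rewrite [p]monalgE.
apply: (big_ind (fun p => pderiv i (p * q) = pderiv i p * q + p * pderiv i q)).
- by rewrite linear0 !mul0r linear0 addr0.
- move=> p1 p2 IH1 IH2; rewrite linearD !mulrDl linearD /= IH1 IH2.
  by rewrite addrACA.
move=> a _; rewrite [q]monalgE; move: << _ *g a >> (monom p@_a a) => f monomf.
apply: (big_ind (fun q => pderiv i (f * q) = pderiv i f * q + f * pderiv i q)).
- by rewrite linear0 !mulr0 linear0 addr0.
- move=> q1 q2 IH1 IH2; rewrite linearD !mulrDr linearD /= IH1 IH2.
  by rewrite addrACA.
by move=> b _; apply: monomf.
Qed.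

Lemma pderiv_is_derivation i : is_poly_derivation (@pderiv K I i).
Proof. by split; [apply: pderiv_is_linear | apply: pderivM]. Qed.

Lemma pderiv_tvar i j : pderiv i (tvar j) = (i == j)%:R.
Proof.
rewrite pderiv_monom mexpUE eq_sym; case: eqP => [->|_]; last exact: monalgU0.
by rewrite mexp_predU.
Qed.

Lemma poly_derivation_ext D D' : is_poly_derivation D -> is_poly_derivation D' ->
  (forall i, D (tvar i) = D' (tvar i)) -> D =1 D'.
Proof.
move=> dD dD' eqt.
have D1 E : is_poly_derivation E -> E 1 = 0.
  move=> [_ EM]; have := EM 1 1; rewrite !(mulr1, mul1r) => /eqP.
  by rewrite -subr_eq subrr => /eqP.
have monom a : D << a >> = D' << a >>.
  elim/mexp_ind: a => [|i a IHa]; first by rewrite (D1 _ dD) (D1 _ dD').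
  have -> : << mmul (mexpU i) a >> = tvar i * << a >> :> P.
    by rewrite malgMU mulr1.
  by rewrite dD.2 dD'.2 eqt IHa.
have [lD lD'] := (dD.1, dD'.1).
pose F : {linear P -> P} := HB.pack D (GRing.isLinear.Build K P P *:%R D lD).
pose F' : {linear P -> P} := HB.pack D' (GRing.isLinear.Build K P P *:%R D' lD').
move=> p; rewrite [p]monalgE -[D _]/(F _) -[D' _]/(F' _) !linear_sum /=.
apply: eq_bigr => a _.
have -> : << p@_a *g a >> = p@_a *: << a >> :> P by rewrite malgZU mulr1.
by rewrite -[D _]/(F _) -[D' _]/(F' _) !linearZ /= monom.
Qed.

End Polynomials.

(* W^+ is the space of finite sums \sum_i f_i d/dt_i. Such a sum is encoded by
   the finitely supported family of its coefficients f_i, that is, as an element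
   of the free module over the polynomial ring; vact v is the derivation of the
   polynomial algebra given by v. By vact_inj and vact_lie this identifies W^+
   with a Lie algebra of derivations under the commutator, and by vact_surj with
   all of them when there are finitely many variables. *)
Definition Wplus (K : fieldType) (I : choiceType) : Type := {malg (polyIn K I)[I]}.

HB.instance Definition _ K I := GRing.Zmodule.on (Wplus K I).

HB.lock
Definition Wcoef (K : fieldType) (I : choiceType) (v : Wplus K I) (i : I) :
  polyIn K I := mcoeff i v.

HB.lock
Definition Wplus_scale (K : fieldType) (I : choiceType) (c : K) (v : Wplus K I) :
  Wplus K I := [malg i in msupp v => c *: Wcoef v i].

HB.lock
Definition vact (K : fieldType) (I : choiceType) (v : Wplus K I)
    (p : polyIn K I) : polyIn K I :=
  \sum_(i <- msupp v) Wcoef v i * pderiv i p.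

HB.lock
Definition Wplus_lie (K : fieldType) (I : choiceType) (u v : Wplus K I) :
    Wplus K I :=
  [malg i in msupp u `|` msupp v => vact u (Wcoef v i) - vact v (Wcoef u i)].

Section Wplus.
Variables (K : fieldType) (I : choiceType).

Local Notation P := (polyIn K I).
Local Notation Wplus := (Wplus K I).

Implicit Types (c : K) (u v w : Wplus) (p q : P) (a b : mexp I) (i j : I).

Lemma WplusP u v : (forall i, Wcoef u i = Wcoef v i) <-> u = v.
Proof. by rewrite -malgP Wcoef.unlock. Qed.

Lemma Wcoef_outdom v i : i \notin msupp v -> Wcoef v i = 0.
Proof. by rewrite Wcoef.unlock; apply: mcoeff_outdom. Qed.

Lemma WcoefD u v i : Wcoef (u + v) i = Wcoef u i + Wcoef v i.
Proof. by rewrite Wcoef.unlock; apply: mcoeffD. Qed.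

Lemma WcoefB u v i : Wcoef (u - v) i = Wcoef u i - Wcoef v i.
Proof. by rewrite Wcoef.unlock; apply: mcoeffB. Qed.

Lemma Wcoef_scale c v i : Wcoef (Wplus_scale c v) i = c *: Wcoef v i.
Proof.
rewrite Wplus_scale.unlock {1}Wcoef.unlock mcoeffE; case: ifP => // /negbT vi.
by rewrite Wcoef_outdom // scaler0.
Qed.

Fact Wplus_scaleA c c' v :
  Wplus_scale c (Wplus_scale c' v) = Wplus_scale (c * c') v.
Proof. by apply/WplusP => i; rewrite !Wcoef_scale scalerA. Qed.

Fact Wplus_scale1 : left_id 1 (@Wplus_scale K I).
Proof. by move=> v; apply/WplusP => i; rewrite Wcoef_scale scale1r. Qed.

Fact Wplus_scaleDr : right_distributive (@Wplus_scale K I) +%R.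
Proof.
move=> c u v; apply/WplusP => i.
by rewrite WcoefD !Wcoef_scale WcoefD scalerDr.
Qed.

Fact Wplus_scaleDl v : {morph (@Wplus_scale K I)^~ v : c c' / c + c'}.
Proof.
move=> c c'; apply/WplusP => i.
by rewrite WcoefD !Wcoef_scale scalerDl.
Qed.

HB.instance Definition _ := GRing.Zmodule_isLmodule.Build K Wplus
  Wplus_scaleA Wplus_scale1 Wplus_scaleDr Wplus_scaleDl.

Lemma WcoefZ c v i : Wcoef (c *: v) i = c *: Wcoef v i.
Proof. exact: Wcoef_scale. Qed.

Lemma vactEw v p (d : {fset I}) : msupp v `<=` d ->
  vact v p = \sum_(i <- d) Wcoef v i * pderiv i p.
Proof.
move=> le; rewrite vact.unlock (big_fset_incl _ le) // => i _ /Wcoef_outdom ->.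
by rewrite mul0r.
Qed.

Lemma vact_is_linear v : linear (vact v).
Proof.
move=> c p q; rewrite vact.unlock scaler_sumr -big_split; apply: eq_bigr => i _ /=.
by rewrite linearP /= mulrDr scalerAr.
Qed.

Lemma vactPr v c p q : vact v (c *: p + q) = c *: vact v p + vact v q.
Proof. exact: vact_is_linear. Qed.

Lemma vactDr v p q : vact v (p + q) = vact v p + vact v q.
Proof. by have := vactPr v 1 p q; rewrite !scale1r. Qed.

HB.instance Definition _ v :=
  GRing.isLinear.Build K P P *:%R (vact v) (vact_is_linear v).

Lemma vactBr v p q : vact v (p - q) = vact v p - vact v q.
Proof. exact: raddfB. Qed.

Lemma vactM v p q : vact v (p * q) = vact v p * q + p * vact v q.
Proof.
rewrite vact.unlock mulr_suml mulr_sumr -big_split; apply: eq_bigr => i _ /=.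
by rewrite pderivM mulrDr mulrA mulrCA.
Qed.

Lemma vact_is_derivation v : is_poly_derivation (vact v).
Proof. by split; [apply: vact_is_linear | apply: vactM]. Qed.

Lemma vact_tvar v i : vact v (tvar K i) = Wcoef v i.
Proof.
rewrite (vactEw _ (fsubsetUr [fset i] (msupp v))).
rewrite (big_fsetD1 i) ?in_fsetU ?in_fset1 ?eqxx //=.
rewrite pderiv_tvar eqxx mulr1 big_seq big1 ?addr0 // => j.
by rewrite in_fsetD1 pderiv_tvar => /andP[/negPf -> _]; rewrite mulr0.
Qed.

Lemma vact_inj u v : vact u =1 vact v -> u = v.
Proof. by move=> uv; apply/WplusP => i; rewrite -!vact_tvar uv. Qed.

Lemma vactP (D : P -> P) : is_poly_derivation D -> forall v,
  (forall i, D (tvar K i) = Wcoef v i) -> D =1 vact v.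
Proof.
move=> dD v Dv; apply: poly_derivation_ext dD (vact_is_derivation v) _ => i.
by rewrite vact_tvar.
Qed.

Lemma Wcoef_lie u v i :
  Wcoef (Wplus_lie u v) i = vact u (Wcoef v i) - vact v (Wcoef u i).
Proof.
rewrite Wplus_lie.unlock {1}Wcoef.unlock mcoeffE in_fsetU; case: ifP => // /norP[ui vi].
by rewrite !Wcoef_outdom // !linear0 addr0.
Qed.

Lemma vact_lie u v p :
  vact (Wplus_lie u v) p = vact u (vact v p) - vact v (vact u p).
Proof.
move: p; apply/fsym/vactP => [|i]; last by rewrite !vact_tvar Wcoef_lie.
split=> [c p q|p q].
  by rewrite !vactPr scalerBr opprD addrACA.
rewrite !vactM -[_ + p * _]addrC !vactDr !vactM; ring.
Qed.

Lemma vactDl u v p : vact (u + v) p = vact u p + vact v p.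
Proof.
rewrite (vactEw _ (msuppD_le u v)) (vactEw _ (fsubsetUl (msupp u) (msupp v))).
rewrite (vactEw _ (fsubsetUr (msupp u) (msupp v))) -big_split.
by apply: eq_bigr => i _ /=; rewrite WcoefD mulrDl.
Qed.

Lemma vactZl c v p : vact (c *: v) p = c *: vact v p.
Proof.
have le : msupp (c *: v) `<=` msupp v.
  apply/fsubsetP => i; apply: contraTT => vi; rewrite -mcoeff_eq0.
  by have := WcoefZ c v i; rewrite (Wcoef_outdom vi) scaler0 Wcoef.unlock => ->.
rewrite (vactEw _ le) vact.unlock scaler_sumr.
by apply: eq_bigr => i _; rewrite WcoefZ scalerAl.
Qed.

Lemma vact0l p : vact 0 p = 0.
Proof. by rewrite vact.unlock msupp0 big_seq_fset0. Qed.

Fact Wplus_lie_linearl w : linear ((@Wplus_lie K I)^~ w).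
Proof.
move=> c u v /=; apply/WplusP => i.
rewrite WcoefD WcoefZ !Wcoef_lie WcoefD WcoefZ vactDl vactZl vactPr.
by rewrite scalerBr opprD addrACA.
Qed.

Fact Wplus_liexx u : Wplus_lie u u = 0.
Proof. by apply: vact_inj => p; rewrite vact_lie subrr vact0l. Qed.

Fact Wplus_lie_linearr u : linear (@Wplus_lie K I u).
Proof.
move=> c v w; apply/WplusP => i.
rewrite WcoefD WcoefZ !Wcoef_lie WcoefD WcoefZ vactDl vactZl vactPr.
by rewrite scalerBr opprD addrACA.
Qed.

Fact Wplus_jacobi u v w : Wplus_lie u (Wplus_lie v w) +
  Wplus_lie v (Wplus_lie w u) + Wplus_lie w (Wplus_lie u v) = 0.
Proof.
apply: vact_inj => p; rewrite !vactDl vact0l !vact_lie !vactBr; ring.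
Qed.

HB.instance Definition _ := isLieAlgebra.Build K Wplus
  Wplus_lie_linearl Wplus_lie_linearr Wplus_liexx Wplus_jacobi.

(* t^a d_i, where d_i = t_i d/dt_i *)
Definition tdmon a i : Wplus := << << a >> * tvar K i *g i >>.

Lemma vact_tdmon a i p : vact (tdmon a i) p = << a >> * tvar K i * pderiv i p.
Proof.
by rewrite (vactEw _ msuppU_le) big_seq_fset1 Wcoef.unlock mcoeffUU.
Qed.

Lemma tvar_pderiv_monom i b :
  tvar K i * pderiv i << b >> = (b i)%:R *: << b >>.
Proof.
rewrite pderiv_monom malgMU mul1r malgZU mulr1.
have [->|bi] := posnP (b i); first by rewrite mulr0n !monalgU0.
by rewrite mexp_predK.
Qed.

Lemma Wcoef_tdmon a i j : Wcoef (tdmon a i) j = (<< a >> * tvar K i) *+ (i == j).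
Proof. by rewrite Wcoef.unlock; apply: mcoeffU. Qed.

Lemma lie_tdmon a i b j :
  lie (tdmon a i) (tdmon b j) =
    (b i)%:R *: tdmon (mmul a b) j - (a j)%:R *: tdmon (mmul a b) i.
Proof.
have tderiv (e : mexp I) k (b' : mexp I) l : << e >> * tvar K k * pderiv k (<< b' >> * tvar K l) =
    (b' k)%:R *: (<< mmul e b' >> * tvar K l) +
    (<< mmul e b' >> * tvar K k) *+ (k == l).
  have -> : << mmul e b' >> = << e >> * << b' >> :> P by rewrite malgMU mulr1.
  rewrite pderivM pderiv_tvar mulrDr [X in X + _]mulrA.
  rewrite -[X in X * _ + _]mulrA tvar_pderiv_monom -!scalerAr -!scalerAl.
  congr (_ + _); case: eqP => _; last by rewrite mulr0 mulr0 mulr0n.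
  by rewrite mulr1n mulr1 mulrAC.
apply/WplusP => k.
rewrite WcoefB !WcoefZ !Wcoef_tdmon.
rewrite [LHS]Wcoef_lie !vact_tdmon !Wcoef_tdmon !linearMn /=.
rewrite !mulrnAr !tderiv [mmul b a]mulmC [j == i]eq_sym.
move: (b i)%:R (a j)%:R => x y.
case: (i =P j) => [->|_]; move: (_ * tvar K j) => A.
  case: (j == k) => /=; last by rewrite !mulr0n oppr0.
  by rewrite !mulr1n opprD addrACA subrr addr0.
move: (_ * tvar K i) => B; rewrite !mulr0n !addr0.
by case: (j == k); case: (i == k); rewrite /= ?mulr0n ?mulr1n ?oppr0.
Qed.

(* the span of the t^a d_i *)
Definition Wplusplus_pred : {pred Wplus} := fun v =>
  `[< exists s : seq (K * mexp I * I),
        v = \sum_(x <- s) x.1.1 *: tdmon x.1.2 x.2 >].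

Lemma Wplusplus_predP v :
  reflect (exists s : seq (K * mexp I * I),
             v = \sum_(x <- s) x.1.1 *: tdmon x.1.2 x.2)
          (v \in Wplusplus_pred).
Proof. exact: asboolP. Qed.

Fact Wplusplus_submod_closed : submod_closed Wplusplus_pred.
Proof.
split; first by apply/Wplusplus_predP; exists [::]; rewrite big_nil.
move=> c u v /Wplusplus_predP[r ->] /Wplusplus_predP[s ->].
apply/Wplusplus_predP.
exists ([seq (c * x.1.1, x.1.2, x.2) | x <- r] ++ s).
rewrite big_cat big_map scaler_sumr; congr (_ + _).
by apply: eq_bigr => x _ /=; rewrite scalerA.
Qed.

HB.instance Definition _ :=
  GRing.isSubmodClosed.Build K Wplus Wplusplus_pred Wplusplus_submod_closed.

Lemma tdmon_Wplusplus a i : tdmon a i \in Wplusplus_pred.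
Proof.
by apply/Wplusplus_predP; exists [:: (1, a, i)]; rewrite big_seq1 scale1r.
Qed.

Lemma Wplusplus_lie u v : u \in Wplusplus_pred -> v \in Wplusplus_pred ->
  lie u v \in Wplusplus_pred.
Proof.
have lieDl w x y : lie (x + y) w = lie x w + lie y w.
  by have := lie_linearl w 1 x y; rewrite !scale1r.
have lieDr w x y : lie w (x + y) = lie w x + lie w y.
  by have := lie_linearr w 1 x y; rewrite !scale1r.
have lie0l w : lie 0 w = 0 by apply: (addIr (lie 0 w)); rewrite -lieDl !add0r.
have lie0r w : lie w 0 = 0 by apply: (addIr (lie w 0)); rewrite -lieDr !add0r.
have lieZl w c x : lie (c *: x) w = c *: lie x w.
  by have := lie_linearl w c x 0; rewrite !addr0 => /= ->; rewrite lie0l addr0.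
have lieZr w c x : lie w (c *: x) = c *: lie w x.
  by have := lie_linearr w c x 0; rewrite !addr0 => /= ->; rewrite lie0r addr0.
move=> /Wplusplus_predP[r ->] /Wplusplus_predP[s ->].
apply: (big_ind (fun x => lie x _ \in Wplusplus_pred)).
- by rewrite lie0l rpred0.
- by move=> x y xP yP; rewrite lieDl rpredD.
move=> x _; apply: (big_ind (fun y => lie _ y \in Wplusplus_pred)).
- by rewrite lie0r rpred0.
- by move=> y z yP zP; rewrite lieDr rpredD.
move=> y _; rewrite lieZl lieZr !rpredZ // lie_tdmon.
by rewrite rpredB // rpredZ // tdmon_Wplusplus.
Qed.

End Wplus.

Lemma vact_surj (K : fieldType) (I : finType) (D : polyIn K I -> polyIn K I) :
  is_poly_derivation D -> exists v : Wplus K I, D =1 vact v.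
Proof.
move=> dD; exists (\sum_(i : I) << D (tvar K i) *g i >>).
apply: vactP => // i; rewrite Wcoef.unlock raddf_sum (bigD1 i) //= mcoeffUU.
rewrite big1 ?addr0 // => j /negPf ji.
by rewrite mcoeffU ji.
Qed.

Section Wplusplus.
Variables (K : fieldType) (I : choiceType).

Record Wplusplus : Type :=
  MkWplusplus { Wpp_val :> Wplus K I; _ : Wpp_val \in @Wplusplus_pred K I }.

HB.instance Definition _ := [isSub for Wpp_val].
HB.instance Definition _ := [Choice of Wplusplus by <:].
HB.instance Definition _ := [SubChoice_isSubLmodule of Wplusplus by <:].

Implicit Types u v w : Wplusplus.

Definition Wplusplus_bracket u v : Wplusplus :=
  MkWplusplus (Wplusplus_lie (valP u) (valP v)).

Fact Wplusplus_bracket_linearl w : linear (Wplusplus_bracket^~ w).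
Proof. by move=> c u v; apply: val_inj; rewrite linearP /= [LHS]lie_linearl. Qed.

Fact Wplusplus_bracket_linearr w : linear (Wplusplus_bracket w).
Proof. by move=> c u v; apply: val_inj; rewrite linearP /= [LHS]lie_linearr. Qed.

Fact Wplusplus_bracketxx u : Wplusplus_bracket u u = 0.
Proof. by apply: val_inj; rewrite linear0 /= liexx. Qed.

Fact Wplusplus_jacobi u v w :
  Wplusplus_bracket u (Wplusplus_bracket v w) +
  Wplusplus_bracket v (Wplusplus_bracket w u) +
  Wplusplus_bracket w (Wplusplus_bracket u v) = 0.
Proof. by apply: val_inj; rewrite linear0 !linearD /= lie_jacobi. Qed.

HB.instance Definition _ := isLieAlgebra.Build K Wplusplus
  Wplusplus_bracket_linearl Wplusplus_bracket_linearr
  Wplusplus_bracketxx Wplusplus_jacobi.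

End Wplusplus.

(* Some n stands for n variables t_0, ..., t_(n-1), None for n = infinity *)
Definition var_index (n : option nat) : choiceType :=
  if n is Some m then 'I_m else nat.

(* Main.v *)
Require Import Defs.
From mathcomp Require Import all_boot all_order all_algebra.
From mathcomp Require Import reals.
From mathcomp.real_closed Require Import complex.
From HB Require Import structures.
From mathcomp Require Import finmap zify ring boolp.
From mathcomp.multinomials Require Import monalg.

(** Write t_k for the variables and d_k for t_k d/dt_k. The argument treats W^+ and
    W^{++} together, as Lie algebras between W^{++} and W^+, and reduces infinitely
    many variables to finitely many: for a finite set [T] of variables, setting the
    others to 0 and forgetting the other components is a morphism of modules over
    the fields in the variables of [T] ([wtrunc_lie]). Linearity and the Leibniz rule
    for a 2-local derivation Delta only involve finitely many elements, hence it
    suffices to show that the truncation of Delta is the bracket with a fixed field.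

    By [der_between_inner], the truncation of any derivation is inner. On W^{++} this
    is a weight argument for the torus spanned by the d_k ([der_inner]): up to an
    inner derivation, the torus is killed, so that t^a d_j goes to a combination of
    the t^a d_k, and the Leibniz rule then determines the coefficients of this
    combination ([leibniz_coef_eq0]). Larger algebras follow because a suitable
    bracket brings any field into W^{++}.

    So Delta(x) and Delta(y) are, for each pair x, y, the brackets of x and of y with
    a common field, which may depend on the pair. The key is a vector field E in
    W^{++} such that, for every nonzero polynomial f in one variable, the centralizer
    of f(t_o) E among the fields in the variables of [T] is the line spanned by
    f(t_o) E ([centralizer_Xf]). The field E is triangular, and its coefficients are
    powers of t_o with distinct exponents; these play the role that linearly
    independent eigenvalues play for a generic diagonal field, and estimates of
    degrees in t_o replace the independence.

    Subtracting an inner derivation, Delta kills E and t_o E. The one-dimensional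
    centralizers of E, t_o E, t_o^2 E and of the combinations of the first two then
    leave no room for a nonzero value at any other element ([local_inner]). *)

Set Implicit Arguments.
Unset Strict Implicit.
Unset Printing Implicit Defensive.

Import GRing.Theory.
Local Open Scope fset_scope.
Local Open Scope ring_scope.

(** * Lie algebras *)

Section LieBasics.
Variables (K : fieldType) (L : lieAlgType K).
Implicit Types (x y z : L) (c : K).

Lemma lieDl x y z : lie (x + y) z = lie x z + lie y z.
Proof. by have := lie_linearl z 1 x y; rewrite !scale1r. Qed.

Lemma lieDr x y z : lie z (x + y) = lie z x + lie z y.
Proof. by have := lie_linearr z 1 x y; rewrite !scale1r. Qed.

Lemma lie0l z : lie 0 z = 0 :> L.
Proof. by apply: (addIr (lie 0 z)); rewrite -lieDl !add0r. Qed.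

Lemma lie0r z : lie z 0 = 0 :> L.
Proof. by apply: (addIr (lie z 0)); rewrite -lieDr !add0r. Qed.

Lemma lieZl c x z : lie (c *: x) z = c *: lie x z.
Proof. by have /= := lie_linearl z c x 0; rewrite !addr0 lie0l addr0. Qed.

Lemma lieZr c x z : lie z (c *: x) = c *: lie z x.
Proof. by have /= := lie_linearr z c x 0; rewrite !addr0 lie0r addr0. Qed.

Lemma lieBl x y z : lie (x - y) z = lie x z - lie y z.
Proof. by rewrite -scaleN1r lieDl lieZl scaleN1r. Qed.

Lemma lieBr x y z : lie z (x - y) = lie z x - lie z y.
Proof. by rewrite -scaleN1r lieDr lieZr scaleN1r. Qed.

Lemma lieC x y : lie x y = - lie y x.
Proof.
apply/eqP; rewrite -addr_eq0; have := liexx (x + y).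
by rewrite lieDl !lieDr !liexx add0r addr0 => ->.
Qed.

Lemma lie_suml (J : Type) (s : seq J) (F : J -> L) z :
  lie (\sum_(j <- s) F j) z = \sum_(j <- s) lie (F j) z.
Proof.
by apply: (big_morph (fun x => lie x z)) => [x y|]; [apply: lieDl | apply: lie0l].
Qed.

Lemma lie_sumr (J : Type) (s : seq J) (F : J -> L) z :
  lie z (\sum_(j <- s) F j) = \sum_(j <- s) lie z (F j).
Proof. by apply: big_morph => [x y|]; [apply: lieDr | apply: lie0r]. Qed.

Lemma lie_derivation u x y : lie u (lie x y) = lie (lie u x) y + lie x (lie u y).
Proof.
have /eqP := lie_jacobi u x y; rewrite -addrA addr_eq0 => /eqP ->.
have -> : lie x (lie u y) = - lie x (lie y u).
  by rewrite [lie u y]lieC -scaleN1r lieZr scaleN1r.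
by rewrite (lieC (lie u x) y) opprD addrC.
Qed.

End LieBasics.

(** * Coefficients of polynomials and of vector fields *)

Section Coefficients.
Variables (K : fieldType) (I : choiceType).

Local Notation P := (polyIn K I).
Local Notation W := (Wplus K I).
Implicit Types (p q : P) (a b : mexp I) (i j k : I) (u v w : W) (T : {fset I}).

Lemma mexp_mulI b : injective (mmul b).
Proof.
move=> a a' /mexpP eq_ba; apply/mexpP => i.
by have := eq_ba i; rewrite !mexpME => /addnI.
Qed.

Lemma poly_ind_monom (Q : P -> Prop) :
  Q 0 -> (forall p q, Q p -> Q q -> Q (p + q)) ->
  (forall c a, Q << c *g a >>) -> forall p, Q p.
Proof.
by move=> Q0 QD Qm p; rewrite [p]monalgE; apply: (big_ind Q) => // a _; apply: Qm.
Qed.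

Lemma mcoeff_pderiv i p a :
  (pderiv i p)@_a = p@_(mmul (mexpU i) a) *+ (a i).+1.
Proof.
elim/poly_ind_monom: p => [|p q IHp IHq|c b].
- by rewrite linear0 !mcoeff0 mul0rn.
- by rewrite linearD !mcoeffD IHp IHq mulrnDl.
rewrite pderiv_monom !mcoeffU; have [bi|bi] := posnP (b i).
  rewrite bi mulr0n mul0rn; case: eqP => [eq_b|_]; last by rewrite mulr0n mul0rn.
  by move: bi; rewrite eq_b mexpME mexpUE eqxx.
have -> : (mexp_pred i b == a) = (b == mmul (mexpU i) a).
  apply/eqP/eqP => [<-|->]; first by rewrite mexp_predK.
  by rewrite mexp_predM ?mexpUE ?eqxx // mexp_predU mul1m.
case: eqP => [->|_]; last by rewrite !mulr0n mul0rn.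
by rewrite mexpME mexpUE eqxx mulr1n add1n.
Qed.

Lemma mcoeff_monomM b p a : (<< b >> * p : P)@_(mmul b a) = p@_a.
Proof.
elim/poly_ind_monom: p => [|p q IHp IHq|c a']; rewrite ?mulr0 ?mulrDr.
- by rewrite !mcoeff0.
- by rewrite !mcoeffD IHp IHq.
by rewrite malgMU mul1r !mcoeffU (inj_eq (@mexp_mulI b)).
Qed.

Lemma monomMI b : injective (fun p => << b >> * p : P).
Proof.
move=> p q /= /malgP eq_pq; apply/malgP => a.
by rewrite -(mcoeff_monomM b p) -(mcoeff_monomM b q) eq_pq.
Qed.

Lemma mcoeff_tvarM i p a :
  (tvar K i * p)@_a = p@_(mexp_pred i a) *+ (0 < a i)%N.
Proof.
have [ai|ai] := posnP (a i); last first.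
  by rewrite -{1}(mexp_predK ai) mcoeff_monomM.
rewrite mulr0n; elim/poly_ind_monom: p => [|p q IHp IHq|c a'].
- by rewrite mulr0 mcoeff0.
- by rewrite mulrDr mcoeffD IHp IHq addr0.
rewrite malgMU mcoeffU; case: eqP => [eq_a|_]; last by rewrite mulr0n.
by move: ai; rewrite -eq_a mexpME mexpUE eqxx.
Qed.

Lemma mcoeff_euler i p a : (tvar K i * pderiv i p)@_a = p@_a *+ a i.
Proof.
rewrite mcoeff_tvarM mcoeff_pderiv mexp_predE eqxx.
have [->|ai] := posnP (a i); first by rewrite !mulr0n.
by rewrite mexp_predK // mulr1n; congr (_ *+ _); lia.
Qed.

Definition cf v k a : K := (Wcoef v k)@_a.

Lemma cfP u v : (forall k a, cf u k a = cf v k a) -> u = v.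
Proof. by move=> uv; apply/WplusP => k; apply/malgP => a; apply: uv. Qed.

Lemma Wcoef0 k : Wcoef (0 : W) k = 0.
Proof. by apply: Wcoef_outdom; rewrite msupp0. Qed.

Lemma cf0 k a : cf 0 k a = 0. Proof. by rewrite /cf Wcoef0 mcoeff0. Qed.

Lemma cfD u v k a : cf (u + v) k a = cf u k a + cf v k a.
Proof. by rewrite /cf WcoefD mcoeffD. Qed.

Lemma cfB u v k a : cf (u - v) k a = cf u k a - cf v k a.
Proof. by rewrite /cf WcoefB mcoeffB. Qed.

Lemma cfN u k a : cf (- u) k a = - cf u k a.
Proof. by rewrite -[- u]sub0r cfB cf0 sub0r. Qed.

Lemma cfZ c u k a : cf (c *: u) k a = c * cf u k a.
Proof. by rewrite /cf WcoefZ mcoeffZ. Qed.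

Lemma cf_sum (J : Type) (s : seq J) (Q : pred J) (F : J -> W) k a :
  cf (\sum_(j <- s | Q j) F j) k a = \sum_(j <- s | Q j) cf (F j) k a.
Proof.
by apply: (big_morph (fun w => cf w k a)) => [u v|]; [apply: cfD | apply: cf0].
Qed.

(** Truncation to some of the variables, and the division by weights that makes
    derivations vanish on the torus, are both operators of this kind. *)
Definition mdiag (phi : mexp I -> K) p : P := [malg a in msupp p => phi a * p@_a].

Lemma mcoeff_mdiag phi p a : (mdiag phi p)@_a = phi a * p@_a.
Proof. by rewrite mcoeffE; case: msuppP; rewrite ?mulr0. Qed.

Definition wdiag (phi : I -> mexp I -> K) v : W :=
  [malg k in msupp v => mdiag (phi k) (Wcoef v k)].

Lemma Wcoef_wdiag phi v k : Wcoef (wdiag phi v) k = mdiag (phi k) (Wcoef v k).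
Proof.
rewrite {1}Wcoef.unlock mcoeffE; case: ifP => // /negbT vk.
by apply/malgP => a; rewrite mcoeff_mdiag Wcoef_outdom // !mcoeff0 mulr0.
Qed.

Lemma cf_wdiag phi v k a : cf (wdiag phi v) k a = phi k a * cf v k a.
Proof. by rewrite /cf Wcoef_wdiag mcoeff_mdiag. Qed.

Lemma wdiagC phi psi v : wdiag phi (wdiag psi v) = wdiag psi (wdiag phi v).
Proof. by apply: cfP => k a; rewrite !cf_wdiag mulrCA. Qed.

End Coefficients.

(** * Truncation to finitely many variables *)

Section Truncation.
Variables (K : fieldType) (I : choiceType).

Local Notation P := (polyIn K I).
Local Notation W := (Wplus K I).
Implicit Types (p q : P) (a b : mexp I) (i j k : I) (u v w : W) (T : {fset I}).

Definition mexp_in T a : bool := finsupp a `<=` T.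

Lemma mexp_inP T a : reflect (forall i, i \notin T -> a i = 0%N) (mexp_in T a).
Proof.
apply: (iffP (@fsubsetP _ (finsupp a) T)) => [aT i iT|aT i].
  by apply/eqP; rewrite cmE_eq0; apply: contra iT; apply: aT.
by rewrite -cmE_neq0; apply: contraR => /aT ->.
Qed.

Lemma mexp_inM T a b : mexp_in T (mmul a b) = mexp_in T a && mexp_in T b.
Proof.
apply/mexp_inP/andP => [abT|[/mexp_inP aT /mexp_inP bT] i iT].
  split; apply/mexp_inP => i /abT; rewrite mexpME; lia.
by rewrite mexpME aT // bT.
Qed.

Lemma mexp_in1 T : mexp_in T mone.
Proof. by apply/mexp_inP => i _; rewrite mexp1E. Qed.

Lemma mexp_inU T i : mexp_in T (mexpU i) = (i \in T).
Proof.
apply/mexp_inP/idP => [iT|iT j jT].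
  by apply: contraT => /iT; rewrite mexpUE eqxx.
by rewrite mexpUE; case: eqP jT => // <-; rewrite iT.
Qed.

Lemma mexp_in_sub T T' a : T `<=` T' -> mexp_in T a -> mexp_in T' a.
Proof. by move=> TT' aT; apply: fsubset_trans TT'. Qed.

(** This is the evaluation of the variables outside [T] at 0, hence a morphism. *)
Definition ptrunc T p : P := mdiag (fun a => (mexp_in T a)%:R) p.

Lemma mcoeff_ptrunc T p a : (ptrunc T p)@_a = p@_a *+ mexp_in T a.
Proof. by rewrite mcoeff_mdiag mulr_natl. Qed.

Fact ptrunc_is_linear T : linear (ptrunc T).
Proof.
move=> c p q; apply/malgP => a.
by rewrite !(mcoeff_ptrunc, mcoeffD, mcoeffZ) mulrnDl mulrnAr.
Qed.

HB.instance Definition _ T :=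
  GRing.isLinear.Build K P P *:%R (ptrunc T) (ptrunc_is_linear T).

Lemma ptrunc_monom T c a : ptrunc T << c *g a >> = << c *+ mexp_in T a *g a >>.
Proof.
apply/malgP => b; rewrite mcoeff_ptrunc !mcoeffU.
by case: eqP => [->|_]; rewrite ?mulr1n // !mulr0n mul0rn.
Qed.

Lemma ptruncM T p q : ptrunc T (p * q) = ptrunc T p * ptrunc T q.
Proof.
elim/poly_ind_monom: p => [|p p' IHp IHp'|c a].
- by rewrite !(mul0r, linear0).
- by rewrite mulrDl !linearD /= IHp IHp' mulrDl.
elim/poly_ind_monom: q => [|q q' IHq IHq'|c' b].
- by rewrite !(mulr0, linear0).
- by rewrite mulrDr !linearD /= IHq IHq' mulrDr.
rewrite malgMU !ptrunc_monom malgMU mexp_inM -mulnb mulrnA.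
by rewrite mulrnAl mulrnAr mulrnAC.
Qed.

Lemma ptrunc_pderiv T i p : i \in T ->
  ptrunc T (pderiv i p) = pderiv i (ptrunc T p).
Proof.
move=> iT; apply/malgP => a; rewrite mcoeff_ptrunc !mcoeff_pderiv mcoeff_ptrunc.
by rewrite mexp_inM mexp_inU iT mulrnAC.
Qed.

Lemma pderiv_ptrunc T i p : i \notin T -> pderiv i (ptrunc T p) = 0.
Proof.
move=> iT; apply/malgP => a; rewrite mcoeff_pderiv mcoeff_ptrunc mcoeff0.
by rewrite mexp_inM mexp_inU (negPf iT) mul0rn.
Qed.

Definition wtrunc T v : W := wdiag (fun k a => ((k \in T) && mexp_in T a)%:R) v.

Lemma cf_wtrunc T v k a :
  cf (wtrunc T v) k a = cf v k a *+ ((k \in T) && mexp_in T a).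
Proof. by rewrite cf_wdiag mulr_natl. Qed.

Lemma Wcoef_wtrunc T v k : Wcoef (wtrunc T v) k = ptrunc T (Wcoef v k) *+ (k \in T).
Proof.
apply/malgP => a; rewrite [LHS]cf_wtrunc mcoeffMn mcoeff_ptrunc.
by rewrite -mulrnA mulnC mulnb.
Qed.

Fact wtrunc_is_linear T : linear (wtrunc T).
Proof.
move=> c u v; apply: cfP => k a.
by rewrite !(cf_wtrunc, cfD, cfZ) mulrnDl mulrnAr.
Qed.

HB.instance Definition _ T :=
  GRing.isLinear.Build K W W *:%R (wtrunc T) (wtrunc_is_linear T).

(** Both the components and the variables of the coefficients are in [T]. *)
Definition Win T v : Prop := wtrunc T v = v.

Lemma WinP T v :
  (forall k a, ~~ ((k \in T) && mexp_in T a) -> cf v k a = 0) <-> Win T v.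
Proof.
split=> [v0|<- k a /negPf kaT]; last by rewrite cf_wtrunc kaT.
apply: cfP => k a; rewrite cf_wtrunc.
by case: (boolP (_ && _)) => [|/v0->].
Qed.

Lemma wtruncK T v : Win T (wtrunc T v).
Proof. by apply/WinP => k a /negPf kaT; rewrite cf_wtrunc kaT. Qed.

Lemma Win_Wcoef T v k : Win T v -> Wcoef v k = ptrunc T (Wcoef v k) *+ (k \in T).
Proof. by move=> vT; rewrite -{1}vT Wcoef_wtrunc. Qed.

Lemma Win_out T v k : Win T v -> k \notin T -> Wcoef v k = 0.
Proof. by move=> vT /negPf kT; rewrite (Win_Wcoef k vT) kT. Qed.

Lemma Win_ptrunc T v k : Win T v -> ptrunc T (Wcoef v k) = Wcoef v k.
Proof.
move=> vT; rewrite (Win_Wcoef k vT) linearMn /=.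
congr (_ *+ _); apply/malgP => a; rewrite !mcoeff_ptrunc.
by case: mexp_in; rewrite ?mul0rn.
Qed.

Lemma vactT T v p : Win T v -> vact v p = \sum_(i <- T) Wcoef v i * pderiv i p.
Proof.
move=> vT; apply: vactEw; apply/fsubsetP => i; apply: contraTT => iT.
by rewrite -mcoeff_eq0; have := Win_out vT iT; rewrite Wcoef.unlock => ->.
Qed.

Lemma ptrunc_vact T v p : Win T v -> ptrunc T (vact v p) = vact v (ptrunc T p).
Proof.
move=> vT; rewrite !(vactT _ vT) linear_sum /= !big_seq.
by apply: eq_bigr => i iT; rewrite ptruncM Win_ptrunc // ptrunc_pderiv.
Qed.

Lemma ptrunc_vact_of T u p :
  ptrunc T p = p -> ptrunc T (vact u p) = vact (wtrunc T u) p.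
Proof.
move=> pT; rewrite (vactT _ (wtruncK T u)) vact.unlock linear_sum /=.
pose d := msupp u `|` T.
have F0 i : i \notin T -> pderiv i p = 0 by move=> iT; rewrite -pT pderiv_ptrunc.
rewrite (big_fset_incl _ (fsubsetUl (msupp u) T)) /=; last first.
  by move=> i _ /Wcoef_outdom ->; rewrite mul0r linear0.
rewrite [RHS](big_fset_incl _ (fsubsetUr (msupp u) T)) /=; last first.
  by move=> i _ /F0 ->; rewrite mulr0.
apply: eq_bigr => i _; rewrite ptruncM Wcoef_wtrunc.
have [iT|iT] := boolP (i \in T); last by rewrite F0 // linear0 !mulr0.
by rewrite ptrunc_pderiv // pT mulr1n.
Qed.

(** Vector fields in the variables of [T] do not see the variables that are set
    to 0, so truncation is a morphism of modules over them. It turns a derivation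
    of the whole algebra into one between vector fields in finitely many
    variables, where all derivations are inner. *)
Lemma wtrunc_lie T u v : Win T v -> wtrunc T (lie u v) = lie (wtrunc T u) v.
Proof.
move=> vT; apply/WplusP => k; rewrite Wcoef_wtrunc.
rewrite [Wcoef (lie _ _) k]Wcoef_lie [RHS]Wcoef_lie Wcoef_wtrunc.
have [kT|kT] := boolP (k \in T); last first.
  by rewrite (Win_out vT kT) !mulr0n !linear0 addr0.
by rewrite !mulr1n linearB /= (ptrunc_vact_of u (Win_ptrunc k vT)) ptrunc_vact.
Qed.

Lemma Win0 T : Win T 0. Proof. exact: linear0. Qed.

Lemma WinD T u v : Win T u -> Win T v -> Win T (u + v).
Proof. by move=> uT vT; rewrite /Win linearD /= uT vT. Qed.

Lemma WinB T u v : Win T u -> Win T v -> Win T (u - v).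
Proof. by move=> uT vT; rewrite /Win linearB /= uT vT. Qed.

Lemma WinZ T c u : Win T u -> Win T (c *: u).
Proof. by move=> uT; rewrite /Win linearZ /= uT. Qed.

Lemma Win_sum T (J : eqType) (s : seq J) (F : J -> W) :
  (forall x, x \in s -> Win T (F x)) -> Win T (\sum_(x <- s) F x).
Proof.
move=> FT; rewrite big_seq.
by apply: (big_ind (Win T)) => [|u v|x /FT//]; [apply: Win0 | apply: WinD].
Qed.

Lemma Win_lie T u v : Win T u -> Win T v -> Win T (lie u v).
Proof. by move=> uT vT; rewrite /Win wtrunc_lie // uT. Qed.

Lemma Win_sub T T' v : T `<=` T' -> Win T v -> Win T' v.
Proof.
move=> TT' /WinP v0; apply/WinP => k a kaT'; apply: v0; apply: contra kaT'.
by case/andP => kT aT; rewrite (fsubsetP TT') //= (mexp_in_sub TT').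
Qed.

Lemma Win_exists v : exists T, Win T v.
Proof.
pose s p : {fset I} := \bigcup_(a <- msupp p) finsupp (a : mexp I).
exists (msupp v `|` \bigcup_(k <- msupp v) s (Wcoef v k)).
apply/WinP => k a; apply: contraNeq => vka.
have kv : k \in msupp v.
  by apply: contraNT vka => kv; rewrite /cf Wcoef_outdom // mcoeff0.
rewrite in_fsetU kv /=; apply: fsubset_trans (fsubsetUr _ _).
apply: fsubset_trans (bigfcup_sup _ kv isT).
have ap : a \in msupp (Wcoef v k) by rewrite -mcoeff_neq0.
exact: bigfcup_sup ap isT.
Qed.

Lemma Win_tdmon T a i : mexp_in T a -> i \in T -> Win T (tdmon K a i).
Proof.
move=> aT iT; apply/WinP => k b; apply: contraNeq.
rewrite /cf Wcoef_tdmon malgMU mcoeffMn mcoeffU.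
case: (i =P k) => [<-|_]; last by rewrite mulr0n eqxx.
case: (_ =P b) => [<- _|_]; last by rewrite mulr0n mul0rn eqxx.
by rewrite mexp_inM aT mexp_inU iT.
Qed.

End Truncation.

(** * Estimates for differential equations in one variable *)

Section OneVariable.
Variables (K : fieldType) (charK0 : [pchar K] =i pred0).
Implicit Types (f g q r v : {poly K}).

Lemma natr_inj0 (m n : nat) : m%:R = n%:R :> K -> m = n.
Proof.
have wlog_le m' n' : (m' <= n')%N -> m'%:R = n'%:R :> K -> m' = n'.
  move=> le /eqP; rewrite eq_sym -subr_eq0 -natrB // (pcharf0P K).1 //; lia.
case: (leqP m n) => [|/ltnW] le eq_mn; first exact: wlog_le.
by apply/esym/wlog_le.
Qed.

(** The degree of X^2 g' is at most deg g + 1, so the term q g wins over the others. *)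
Lemma dominant_term_eq0 f g q r : f != 0 -> (2 < size q)%N ->
  (size r <= (size f).+1)%N -> f * ('X^2 * g^`() + q * g) = r * g -> g = 0.
Proof.
move=> f0 q2 rf eqfg; apply/eqP; apply: contraT => g0.
have q0 : q != 0 by rewrite -size_poly_gt0; lia.
have [sf sg] : (0 < size f)%N /\ (0 < size g)%N by rewrite !size_poly_gt0.
have eq1 : f * q * g = r * g - f * ('X^2 * g^`()).
  by rewrite -eqfg mulrDr addrC addKr mulrA.
have s1 : size (f * q * g)%R = (size f + size q + size g - 2)%N.
  rewrite !size_mul ?mulf_neq0 //; move: q2 sf sg.
  by move: (size f) (size q) (size g) => a b c; lia.
have s2 : (size (r * g)%R <= size f + size g)%N.
  have := size_polyMleq r g. lia.
have s3 : (size (f * ('X^2 * g^`()))%R <= size f + size g)%N.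
  have := size_polyMleq f ('X^2 * g^`()); have := size_polyMleq 'X^2 g^`().
  have := lt_size_deriv g0; rewrite size_polyXn; lia.
have := size_polyD (r * g) (- (f * ('X^2 * g^`()))).
rewrite -eq1 s1 size_polyN; move: s2 s3 q2 sf sg.
move: (size f) (size q) (size g) (size (r * g)%R) (size (f * ('X^2 * g^`()))%R).
by move=> *; lia.
Qed.

Lemma dominant_term_const g q c : (2 < size q)%N ->
  'X^2 * g^`() + q * g = c%:P -> g = 0.
Proof.
move=> q2 eqg; apply/eqP; apply: contraT => g0.
have q0 : q != 0 by rewrite -size_poly_gt0; lia.
have s1 : size (q * g)%R = (size q + size g).-1 by rewrite size_mul.
have eq_qg : q * g = c%:P - 'X^2 * g^`() by rewrite -eqg addrC addKr.
have := size_polyD c%:P (- ('X^2 * g^`())).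
rewrite -eq_qg s1 size_polyN; move: q2 (size_polyC_leq1 c).
have := size_polyMleq 'X^2 g^`(); have := lt_size_deriv g0; rewrite size_polyXn.
move: (size q) (size g) (size c%:P) (size g^`()) (size ('X^2 * g^`())%R).
by move=> *; lia.
Qed.

Lemma coefM_top f g m n : (size f <= m.+1)%N -> (size g <= n.+1)%N ->
  (f * g)`_(m + n) = f`_m * g`_n.
Proof.
move=> fm gn; have lt_m : (m < (m + n).+1)%N by lia.
rewrite coefM (bigD1 (Ordinal lt_m)) //= addKn big1 ?addr0 // => j.
rewrite -val_eqE /= => jm.
have [lt_jm|le_mj] := ltnP j m.
  by rewrite [g`__]nth_default ?mulr0 //; apply: leq_trans gn _; lia.
by rewrite [f`__]nth_default ?mul0r //; apply: leq_trans fm _; lia.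
Qed.

(** Formally g / v has derivative 0, so g is a multiple of v; comparing the leading
    terms avoids fractions. *)
Lemma wronskian_eq0 v g : v != 0 -> v * g^`() = v^`() * g ->
  g`_(size v).-1 = 0 -> g = 0.
Proof.
move=> v0 eqvg gv; apply/eqP; apply: contraT => g0; case/negP: (g0).
set m := (size v).-1 in gv; pose n := (size g).-1.
have sv : size v = m.+1 by rewrite /m prednK // size_poly_gt0.
have sg : size g = n.+1 by rewrite /n prednK // size_poly_gt0.
have xd (h : {poly K}) k : ('X * h^`())`_k = h`_k *+ k.
  by rewrite coefXM coef_deriv; case: k.
have sxd (h : {poly K}) d : size h = d.+1 -> (size ('X * h^`())%R <= d.+1)%N.
  by move=> sh; apply/leq_sizeP => j hj; rewrite xd nth_default ?mul0rn // sh.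
have : (v * ('X * g^`()))`_(m + n) = ('X * v^`() * g)`_(m + n).
  by rewrite mulrCA eqvg mulrA.
rewrite !coefM_top ?sv ?sg ?(sxd _ _ sg) ?(sxd _ _ sv) // !xd.
have vm : v`_m != 0 by rewrite -[m]/((size v).-1) -lead_coefE lead_coef_eq0.
have gn : g`_n != 0 by rewrite -[n]/((size g).-1) -lead_coefE lead_coef_eq0.
rewrite -[g`_n *+ n]mulr_natl -[v`_m *+ m]mulr_natr.
rewrite -mulrA => /(mulfI vm) /(mulIf gn) /natr_inj0 nm.
by rewrite -lead_coef_eq0 lead_coefE -/n nm gv.
Qed.

End OneVariable.

(** * Slices along one variable *)

HB.lock
Definition emb (K : fieldType) (I : choiceType) (o : I) (f : {poly K}) :
    polyIn K I :=
  horner_alg (tvar K o) f.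

Section Slices.
Variables (K : fieldType) (I : choiceType) (o : I).

Local Notation P := (polyIn K I).
Local Notation W := (Wplus K I).
Implicit Types (p q : P) (a b : mexp I) (i j k : I) (u v w : W) (f g : {poly K}).

Definition opow n : mexp I := iter n (mmul (mexpU o)) mone.

Lemma opowE n i : opow n i = (n * (o == i))%N.
Proof.
elim: n => [|n IHn]; first exact: mexp1E.
by rewrite [opow _]iterS mexpME mexpUE IHn; lia.
Qed.

Lemma opowM_o n b : b o = 0%N -> (mmul (opow n) b) o = n.
Proof. by move=> bo; rewrite mexpME opowE eqxx bo; lia. Qed.

Lemma opowM_neq n b i : i != o -> (mmul (opow n) b) i = b i.
Proof. by rewrite eq_sym => /negPf io; rewrite mexpME opowE io muln0. Qed.

(** When b o = 0 this is the coefficient in K[t_o] of t^b in p, seen as a polynomial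
    in the other variables. *)
Definition slice b p : {poly K} :=
  \poly_(n < (\max_(a <- msupp p) (a : mexp I) o).+1) p@_(mmul (opow n) b).

Lemma coef_slice b p n : b o = 0%N -> (slice b p)`_n = p@_(mmul (opow n) b).
Proof.
move=> bo; rewrite coef_poly; case: ltnP => // le_n.
case: msuppP => // pb; move: le_n; rewrite ltnNge => /negP[].
rewrite -{1}(opowM_o n bo).
exact: (@leq_bigmax_seq _ _ xpredT (fun a : mexp I => a o) _ pb isT).
Qed.

Lemma slice_eq0 p : (forall b, b o = 0%N -> slice b p = 0) -> p = 0.
Proof.
move=> s0; apply/malgP => a; rewrite mcoeff0.
pose b := MExp (divcm a (opow (a o))).
have bE i : b i = (a i - a o * (o == i))%N by rewrite divcmE -opowE.
have bo : b o = 0%N by rewrite bE eqxx; lia.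
have -> : a = mmul (opow (a o)) b.
  by apply/mexpP => i; rewrite mexpME opowE bE; case: eqP => [<-|_]; lia.
by rewrite -coef_slice // s0 // coef0.
Qed.

Fact slice_is_linear b : b o = 0%N -> linear (slice b).
Proof.
move=> bo c p q; apply/polyP => n.
by rewrite !(coefD, coefZ, coef_slice) // mcoeffD mcoeffZ.
Qed.

Section FixedSlice.
Variables (b : mexp I) (bo : b o = 0%N).

Lemma sliceD p q : slice b (p + q) = slice b p + slice b q.
Proof. by have := slice_is_linear bo 1 p q; rewrite !scale1r. Qed.

Lemma slice0 : slice b 0 = 0.
Proof. by apply/polyP => n; rewrite coef_slice // mcoeff0 coef0. Qed.

Lemma sliceZ c p : slice b (c *: p) = c *: slice b p.
Proof. by have := slice_is_linear bo c p 0; rewrite !addr0 slice0 addr0. Qed.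

Lemma slice_sum (J : Type) (s : seq J) (Q : pred J) (F : J -> P) :
  slice b (\sum_(j <- s | Q j) F j) = \sum_(j <- s | Q j) slice b (F j).
Proof. by apply: big_morph; [apply: sliceD | apply: slice0]. Qed.

Lemma slice_tvarM_o p : slice b (tvar K o * p) = 'X * slice b p.
Proof.
apply/polyP => n; rewrite coefXM !coef_slice // mcoeff_tvarM opowM_o //.
case: n => [|n] /=; rewrite ?mulr0n // mulr1n.
by rewrite -mulmA mexp_predM ?mexpUE ?eqxx // mexp_predU mul1m.
Qed.

Lemma slice_pderiv_o p : slice b (pderiv o p) = (slice b p)^`().
Proof.
apply/polyP => n; rewrite coef_deriv !coef_slice // mcoeff_pderiv opowM_o //=.
by rewrite mulmA.
Qed.

Lemma slice_euler i p : i != o ->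
  slice b (tvar K i * pderiv i p) = slice b p *+ b i.
Proof.
move=> io; apply/polyP => n.
by rewrite coefMn !coef_slice // mcoeff_euler opowM_neq.
Qed.

End FixedSlice.

Lemma pred_o i b : i != o -> b o = 0%N -> (mexp_pred i b) o = 0%N.
Proof. by rewrite mexp_predE => _ ->. Qed.

Lemma slice_tvarM i b p : i != o -> b o = 0%N ->
  slice b (tvar K i * p) = slice (mexp_pred i b) p *+ (0 < b i)%N.
Proof.
move=> io bo; apply/polyP => n.
rewrite coefMn !coef_slice ?pred_o // mcoeff_tvarM opowM_neq //.
case: posnP => [|bi] /=; first by rewrite !mulr0n.
by rewrite mulmC mexp_predM // mulmC.
Qed.

Lemma slice_tvar_euler i b p : i != o -> b o = 0%N ->
  slice b (tvar K i * (tvar K i * pderiv i p)) =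
  slice (mexp_pred i b) p *+ (b i).-1.
Proof.
move=> io bo; rewrite slice_tvarM // slice_euler ?pred_o // mexp_predE eqxx.
by case: (b i) => [|[|n]] //=; rewrite ?subn0 mulr1n subn1.
Qed.

Local Notation emb := (emb o).

Lemma embD f g : emb (f + g) = emb f + emb g.
Proof. by rewrite emb.unlock rmorphD. Qed.

Lemma embB f g : emb (f - g) = emb f - emb g.
Proof. by rewrite emb.unlock rmorphB. Qed.

Lemma embM f g : emb (f * g) = emb f * emb g.
Proof. by rewrite emb.unlock rmorphM. Qed.

Lemma emb0 : emb 0 = 0 :> P.
Proof. by rewrite emb.unlock rmorph0. Qed.

Lemma emb1 : emb 1 = 1 :> P.
Proof. by rewrite emb.unlock rmorph1. Qed.

Lemma embX : emb 'X = tvar K o.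
Proof. by rewrite emb.unlock horner_algX. Qed.

Lemma embC (c : K) : emb c%:P = c%:A :> P.
Proof. by rewrite emb.unlock horner_algC. Qed.

Lemma embZ (c : K) f : emb (c *: f) = c *: emb f.
Proof. by rewrite -mul_polyC embM embC -scalerAl mul1r. Qed.

Lemma slice_emb f b p : b o = 0%N -> slice b (emb f * p) = f * slice b p.
Proof.
move=> bo; elim/poly_ind: f => [|f c IHf]; first by rewrite emb0 !mul0r slice0.
rewrite embD embM embX embC [emb f * _]mulrC mulrDl sliceD //.
rewrite -mulrA slice_tvarM_o //.
by rewrite IHf -scalerAl mul1r sliceZ // mulrDl mulrA ['X * f]mulrC mul_polyC.
Qed.

Lemma slice_emb1 f : slice mone (emb f) = f.
Proof.
rewrite -[emb f]mulr1 slice_emb ?mexp1E //.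
suff -> : slice mone 1 = 1 by rewrite mulr1.
apply/polyP => n; rewrite coef_slice ?mexp1E // mulm1 mcoeff1 coef1.
congr (_ %:R); case: n => [|n] /=; first by rewrite eqxx.
by case: eqP => // /mexpP/(_ o); rewrite mexpME mexpUE eqxx mexp1E.
Qed.

Lemma vact_emb v f : vact v (emb f) = emb f^`() * Wcoef v o.
Proof.
have v1 c : vact v (c%:A) = 0.
  have := vactM v 1 1; rewrite !mulr1 !mul1r linearZ => /eqP /=.
  by rewrite -subr_eq subrr => /eqP <-; rewrite scaler0.
elim/poly_ind: f => [|f c IHf]; first by rewrite deriv0 !emb0 linear0 mul0r.
rewrite embD embM embX embC vactDr v1 addr0 vactM IHf vact_tvar.
by rewrite derivD derivC addr0 derivM derivX mulr1 embD embM embX mulrDl mulrAC.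
Qed.

End Slices.

(** * Vector fields with one-dimensional centralizer *)

(** Any injection of [T] into the integers >= 2 would do as exponents. *)
Definition ew (I : choiceType) (T : {fset I}) (i : I) : nat :=
  (index i (enum_fset T)).+2.

Definition Ecoef (K : fieldType) (I : choiceType) (T : {fset I}) (o i : I) :
    polyIn K I :=
  if i == o then emb o 'X^2
  else emb o 'X^(ew T i) * tvar K i + tvar K i * tvar K i.

(** The vector field f(t_o) E, where
    E = t_o^2 d/dt_o + \sum_(i in T, i != o) (t_o^(ew i) t_i + t_i^2) d/dt_i. *)
HB.lock
Definition Xf (K : fieldType) (I : choiceType) (T : {fset I}) (o : I)
    (f : {poly K}) : Wplus K I :=
  [malg i in T => emb o f * Ecoef K T o i].

Section Centralizer.
Variables (K : fieldType) (charK0 : [pchar K] =i pred0).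
Variables (I : choiceType) (T : {fset I}) (o : I) (oT : o \in T).

Local Notation P := (polyIn K I).
Local Notation W := (Wplus K I).
Local Notation t := (tvar K).
Local Notation slice := (slice o).
Local Notation emb := (emb o).
Local Notation ew := (ew T).
Local Notation Ecoef := (Ecoef K T o).
Local Notation Xf := (Xf T o).
Implicit Types (p q : P) (a b : mexp I) (i j k : I) (u v w : W) (f g : {poly K}).

Lemma ew_inj i j : i \in T -> j \in T -> ew i = ew j -> i = j.
Proof. by move=> iT jT [/(index_inj i iT jT)]. Qed.

Lemma Wcoef_Xf f i : Wcoef (Xf f) i = if i \in T then emb f * Ecoef i else 0.
Proof. by rewrite Xf.unlock Wcoef.unlock mcoeffE. Qed.

Lemma XfD f g : Xf (f + g) = Xf f + Xf g.
Proof.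
apply/WplusP => i; rewrite WcoefD !Wcoef_Xf embD mulrDl.
by case: ifP; rewrite ?addr0.
Qed.

Lemma XfZ c f : Xf (c *: f) = c *: Xf f.
Proof.
apply/WplusP => i; rewrite WcoefZ !Wcoef_Xf embZ -scalerAl.
by case: ifP; rewrite ?scaler0.
Qed.

Lemma ptrunc_tvar i : i \in T -> ptrunc T (t i) = t i.
Proof. by move=> iT; rewrite ptrunc_monom mexp_inU iT. Qed.

Lemma ptrunc1 : ptrunc T (1 : P) = 1.
Proof. by rewrite ptrunc_monom mexp_in1. Qed.

Lemma ptrunc_emb f : ptrunc T (emb f) = emb f.
Proof.
elim/poly_ind: f => [|f c IHf]; first by rewrite emb0 linear0.
rewrite embD embM embX embC linearD /= ptruncM IHf linearZ /= ptrunc1.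
by rewrite ptrunc_tvar.
Qed.

Lemma ptrunc_Ecoef i : i \in T -> ptrunc T (Ecoef i) = Ecoef i.
Proof.
move=> iT; rewrite /Ecoef; case: ifP => _; first exact: ptrunc_emb.
by rewrite linearD /= !ptruncM ptrunc_emb ptrunc_tvar.
Qed.

Lemma Win_Xf f : Win T (Xf f).
Proof.
apply/WplusP => i; rewrite Wcoef_wtrunc Wcoef_Xf; case: ifP => // iT.
by rewrite ptruncM ptrunc_emb ptrunc_Ecoef.
Qed.

Lemma vact_Xf f p : vact (Xf f) p = emb f * vact (Xf 1) p.
Proof.
rewrite !(vactT _ (Win_Xf _)) mulr_sumr !big_seq; apply: eq_bigr => i iT.
by rewrite !Wcoef_Xf iT emb1 mul1r mulrA.
Qed.

Definition wtpoly b : {poly K} := \sum_(i <- T `\ o) 'X^(ew i) *+ b i.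

(** On slices, E is a triangular system of differential operators: the term t_i^2
    d/dt_i raises the degree in t_i, and the other ones act on the slice at t^b by
    X^2 d/dX and by multiplication by [wtpoly b]. Since the exponents [ew i] are
    distinct and at least 2, [wtpoly b] has degree at least 2 as soon as t^b
    involves a variable of [T] other than t_o; then it dominates X^2 d/dX. *)
Lemma slice_Xf f b p : b o = 0%N ->
  slice b (vact (Xf f) p) =
  f * ('X^2 * (slice b p)^`() + wtpoly b * slice b p
       + \sum_(i <- T `\ o) slice (mexp_pred i b) p *+ (b i).-1).
Proof.
move=> bo; rewrite vact_Xf slice_emb //; congr (_ * _).
rewrite (vactT _ (Win_Xf _)) (big_fsetD1 o oT) /= sliceD // -addrA.
rewrite Wcoef_Xf oT emb1 mul1r /Ecoef eqxx slice_emb // slice_pderiv_o //.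
congr (_ + _); rewrite slice_sum // mulr_suml -big_split /= !big_seq.
apply: eq_bigr => i; rewrite in_fsetD1 => /andP[io iT].
rewrite Wcoef_Xf iT emb1 mul1r /Ecoef (negPf io) mulrDl sliceD // -!mulrA.
by rewrite slice_emb // slice_euler // slice_tvar_euler // mulrnAl mulrnAr.
Qed.

Lemma coef_wtpoly b j : j \in T `\ o -> (wtpoly b)`_(ew j) = (b j)%:R.
Proof.
move=> jT; have /fsetD1P[_ jT'] := jT.
rewrite coef_sum (big_fsetD1 j jT) /= coefMn coefXn eqxx big_seq.
rewrite big1 ?addr0 // => i; rewrite !in_fsetD1 => /and3P[ij _ iT].
rewrite coefMn coefXn; case: eqP => [/esym/(ew_inj iT jT') eq_ij|_].
  by rewrite eq_ij eqxx in ij.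
by rewrite mul0rn.
Qed.

Lemma size_gt_ew (q : {poly K}) j : q`_(ew j) != 0 -> (2 < size q)%N.
Proof.
apply: contraR; rewrite -leqNgt => q2.
by rewrite nth_default //; apply: leq_trans q2 _.
Qed.

Definition mu b : nat := (\sum_(i <- T `\ o) b i)%N.

Lemma mu_pred i b : i \in T `\ o -> (0 < b i)%N -> (mu (mexp_pred i b) < mu b)%N.
Proof.
move=> iT bi; rewrite /mu !(big_fsetD1 i iT) /= mexp_predE eqxx -addSn.
rewrite leq_add //; first by lia.
by apply: leq_sum => j _; rewrite mexp_predE; lia.
Qed.

Lemma slice_out b p k : ptrunc T p = p -> k \notin T -> b k != 0%N -> b o = 0%N ->
  slice b p = 0.
Proof.
move=> pT kT bk bo; apply/polyP => n; rewrite coef_slice // -pT mcoeff_ptrunc coef0.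
case: (mexp_inP _ _) => [/(_ k kT)|_]; last by rewrite mulr0n.
by rewrite mexpME => /eqP; rewrite addn_eq0 (negPf bk) andbF.
Qed.

Section Commuting.
Variables (f : {poly K}) (f0 : f != 0) (u : W) (uT : Win T u).
Hypothesis comm_u : lie (Xf f) u = 0.

Lemma comm_coef k : vact (Xf f) (Wcoef u k) = vact u (Wcoef (Xf f) k).
Proof.
have := Wcoef_lie (Xf f) u k; rewrite [Wplus_lie _ _]comm_u Wcoef0 => /eqP.
by rewrite eq_sym subr_eq0 => /eqP.
Qed.

(** The component of [u] on d/dt_o is a function of t_o alone, by induction on the
    degree in the other variables; as such it is proportional to f(t_o) t_o^2. *)
Lemma comm_coef_o_eq0 :
  (slice mone (Wcoef u o))`_(size (f * 'X^2)).-1 = 0 -> Wcoef u o = 0.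
Proof.
move=> u0; apply: (@slice_eq0 _ _ o) => b.
have [n] := ubnP (mu b); elim: n b => // n IHn b le_b bo.
have := congr1 (slice b) (comm_coef o).
rewrite Wcoef_Xf oT /Ecoef eqxx -embM vact_emb slice_emb // slice_Xf //.
rewrite [X in _ + X]big_seq [X in _ + X]big1 ?addr0 => [|i iT]; last first.
  case: (ltnP 1 (b i)) => bi; last by case: (b i) bi => [|[]].
  rewrite IHn ?mul0rn ?pred_o //; last by move: iT; rewrite in_fsetD1 => /andP[].
  by rewrite -ltnS; apply: leq_trans le_b; rewrite ltnS; apply: mu_pred iT _; lia.
move=> eq_b; have [b1|/eqP b1] := eqVneq b mone.
  apply: (@wronskian_eq0 K charK0 (f * 'X^2)).
  - by rewrite mulf_neq0 // -size_poly_eq0 size_polyXn.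
  - rewrite -eq_b -mulrA; congr (_ * _).
    have -> : wtpoly b = 0 by rewrite b1 /wtpoly big1 // => i _; rewrite mexp1E.
    by rewrite mul0r addr0.
  by rewrite b1.
have [i bi] : exists i, b i != 0%N.
  apply: contra_notP b1 => b1; apply/mexpP => i; rewrite mexp1E.
  by apply/eqP; apply: contra_notT b1 => bi; exists i.
have io : i != o by apply: contraNneq bi => ->; rewrite bo.
have [iT|iT] := boolP (i \in T); last exact: slice_out (Win_ptrunc o uT) iT bi bo.
apply: dominant_term_eq0 f0 _ _ eq_b.
  apply: (@size_gt_ew _ i); rewrite coef_wtpoly ?in_fsetD1 ?io //.
  by rewrite (pcharf0P K).1.
have v0 : f * 'X^2 != 0 by rewrite mulf_neq0 // -size_poly_eq0 size_polyXn.
by have := lt_size_deriv v0; rewrite size_mulXn // add2n ltnS.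
Qed.

(** Here the operator on the slice at t^b is X^2 d/dX + [wtpoly b] - X^(ew k), for
    which domination only fails at t^b = t_k: this is the symmetry t_k d/dt_k of
    the linear part of E, which the term t_k^2 d/dt_k of E breaks. *)
Lemma comm_coef_eq0 k : Wcoef u o = 0 -> Wcoef u k = 0.
Proof.
move=> uo0; have [kT|/(Win_out uT)//] := boolP (k \in T).
have [->//|ko] := eqVneq k o.
set w := Wcoef u k; pose h b := slice b w.
have kT' : k \in T `\ o by rewrite in_fsetD1 ko.
have eq_slice b : b o = 0%N -> 'X^2 * (h b)^`() + (wtpoly b - 'X^(ew k)) * h b =
    h (mexp_pred k b) *+ (0 < b k)%N *+ 2
    - \sum_(i <- T `\ o) h (mexp_pred i b) *+ (b i).-1.
  move=> bo; have := congr1 (slice b) (comm_coef k).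
  rewrite slice_Xf // Wcoef_Xf kT vactM vact_emb uo0 mulr0 mul0r add0r slice_emb //.
  move=> /(mulfI f0) /=; rewrite -/(h b) /Ecoef (negPf ko) vactDr !vactM vact_emb.
  rewrite uo0 mulr0 mul0r add0r vact_tvar -/w [w * t k]mulrC -mulr2n.
  rewrite sliceD // slice_emb // -/(h b) -scaler_nat sliceZ // slice_tvarM //.
  rewrite -/(h _) scaler_nat => /(canRL (addrK _)) eq_h.
  by rewrite mulrBl addrA eq_h; ring.
have kE : 'X^(ew k) = wtpoly (mexpU k).
  rewrite /wtpoly (big_fsetD1 k kT') /= mexpUE eqxx big_seq big1 ?addr0 // => i.
  by rewrite in_fsetD1 mexpUE eq_sym => /andP[/negPf -> _].
apply: (@slice_eq0 _ _ o) => b; have [n] := ubnP (mu b).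
elim: n b => // n IHn b le_b bo; rewrite -/w -/(h b).
have IHpred i : i \in T `\ o -> (0 < b i)%N -> h (mexp_pred i b) = 0.
  move=> iT bi; apply: IHn; last by rewrite pred_o //; case/fsetD1P: iT.
  by rewrite -ltnS; apply: leq_trans le_b; rewrite ltnS mu_pred.
have sum0 : \sum_(i <- T `\ o) h (mexp_pred i b) *+ (b i).-1 = 0.
  rewrite big_seq big1 // => i iT; case: (ltnP 1 (b i)) => bi.
    by rewrite IHpred ?mul0rn //; lia.
  by case: (b i) bi => [|[]].
have rhs0 : h (mexp_pred k b) *+ (0 < b k)%N = 0.
  by case: posnP => [|bk]; rewrite ?mulr0n // IHpred ?mul0rn.
have := eq_slice b bo; rewrite sum0 rhs0 mul0rn subr0 => eq_b.
have [/hasP[j jT bj]|/hasPn eq_bk] :=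
    boolP (has (fun j => b j != (k == j)) (T `\ o)).
  apply: (@dominant_term_const K _ _ 0 _ eq_b); apply: (@size_gt_ew _ j).
  rewrite kE coefB !coef_wtpoly // mexpUE subr_eq0.
  by apply: contra bj => /eqP /(natr_inj0 charK0) ->.
have bE j : j \in T `\ o -> b j = (k == j).
  by move=> /eq_bk; rewrite negbK => /eqP.
have wb : wtpoly b = 'X^(ew k).
  by rewrite kE; apply: eq_big_seq => j jT; rewrite bE // mexpUE.
have hb_const : h b = ((h b)`_0)%:P.
  move: eq_b; rewrite wb subrr mul0r addr0 => /eqP.
  rewrite mulf_eq0 -size_poly_eq0 size_polyXn /= => /eqP db0.
  apply/polyP => -[|m]; rewrite coefC //=.
  have := congr1 (fun p : {poly K} => p`_m) db0; rewrite coef_deriv coef0 => /eqP.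
  by rewrite -mulr_natr mulf_eq0 (pcharf0P K).1 // orbF => /eqP.
(* The slice at t_k is a constant, which has to be cancelled at t_k^2. *)
pose c : mexp I := mmul (mexpU k) b.
have ck : c k = 2%N by rewrite mexpME mexpUE eqxx bE // eqxx.
have cE i : i \in T `\ o -> i != k -> c i = 0%N.
  by move=> iT /negPf ik; rewrite mexpME mexpUE bE // eq_sym ik.
have pred_c : mexp_pred k c = b.
  by rewrite mexp_predM ?mexpUE ?eqxx // mexp_predU mul1m.
have co : c o = 0%N by rewrite mexpME mexpUE (negPf ko) bo.
have := eq_slice c co; rewrite (big_fsetD1 k kT') /= ck pred_c mulr1n.
rewrite big_seq big1 => [|i]; last first.
  by rewrite in_fsetD1 => /andP[ik iT]; rewrite cE.
rewrite addr0 mulr2n addrK {1}hb_const => eq_c.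
have hc0 : h c = 0.
  apply: dominant_term_const eq_c; apply: (@size_gt_ew _ k).
  rewrite kE coefB !coef_wtpoly // mexpUE eqxx ck -natrB // subn1.
  by rewrite oner_eq0.
by move: eq_c; rewrite hc0 deriv0 !mulr0 addr0 -hb_const => <-.
Qed.

End Commuting.

(** Subtracting a multiple of [Xf f] kills the component on d/dt_o, hence all. *)
Lemma centralizer_Xf f u : f != 0 -> Win T u -> lie (Xf f) u = 0 ->
  exists c, u = c *: Xf f.
Proof.
move=> f0 uT comm_u; pose v := f * 'X^2.
have v0 : v != 0 by rewrite mulf_neq0 // -size_poly_eq0 size_polyXn.
pose n := (size v).-1; pose c := (slice mone (Wcoef u o))`_n / v`_n; exists c.
pose u' := u - c *: Xf f.
have u'T : Win T u' by apply: WinB uT _; apply/WinZ/Win_Xf.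
have comm_u' : lie (Xf f) u' = 0 by rewrite lieBr lieZr liexx comm_u scaler0 subr0.
have u'o : Wcoef u' o = 0.
  apply: (comm_coef_o_eq0 f0 u'T comm_u'); rewrite -/v -/n WcoefB WcoefZ -scaleN1r.
  rewrite sliceD ?sliceZ ?mexp1E // Wcoef_Xf oT /Ecoef eqxx -embM slice_emb1 -/v.
  rewrite coefD !coefZ mulN1r divfK ?subrr //.
  by rewrite -lead_coefE lead_coef_eq0.
apply/eqP; rewrite -subr_eq0 -/u'; apply/eqP/WplusP => k.
by rewrite Wcoef0; exact: (comm_coef_eq0 f0 u'T comm_u').
Qed.

Lemma lie_Xf f g : lie (Xf f) (Xf g) = Xf ('X^2 * (f * g^`() - g * f^`())).
Proof.
apply/WplusP => i; rewrite [LHS]Wcoef_lie !Wcoef_Xf.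
have [iT|iT] := boolP (i \in T); last by rewrite !linear0 addr0.
rewrite (vact_Xf f).
rewrite (vact_Xf g).
rewrite (vactM _ (emb f)).
rewrite (vactM _ (emb g)).
rewrite (vact_emb o _ f) (vact_emb o _ g) Wcoef_Xf oT emb1 mul1r.
have -> : Ecoef o = emb 'X^2 by rewrite /Ecoef eqxx.
rewrite (embM _ 'X^2) embB (embM _ f) (embM _ g).
move: (emb f) (emb g) (emb f^`()) (emb g^`()) (emb 'X^2) (Ecoef i) (vact _ _).
by move=> *; ring.
Qed.

Lemma Xf_inj f g : Xf f = Xf g -> f = g.
Proof.
move=> eq_fg; have := congr1 (fun v => slice mone (Wcoef v o)) eq_fg.
rewrite /= !Wcoef_Xf oT /Ecoef eqxx -!embM !slice_emb1 => /mulIf; apply.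
by rewrite -size_poly_eq0 size_polyXn.
Qed.

End Centralizer.

(** * Derivations of the vector fields tangent to the coordinate hyperplanes *)

Section StructureConstants.
Variables (K : fieldType) (charK0 : [pchar K] =i pred0).
Variables (I : choiceType) (T : {fset I}).
Implicit Types (a b : mexp I) (i j k l : I).

(** A derivation that preserves the weights maps t^a d_j to the sum over k of the
    A a j k t^a d_k; this is the Leibniz rule for t^a d_i and t^b d_j, on the
    coefficient of t^(a+b) d_k. *)
Definition leibniz_coef (A : mexp I -> I -> I -> K) : Prop :=
  forall a b i j k, mexp_in T a -> mexp_in T b -> i \in T -> j \in T -> k \in T ->
    (b i)%:R * A (mmul a b) j k - (a j)%:R * A (mmul a b) i k =
    - ((a j)%:R * A a i k - (j == k)%:R * \sum_(l <- T) (b l)%:R * A a i l)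
    + ((b i)%:R * A b j k - (i == k)%:R * \sum_(l <- T) (a l)%:R * A b j l).

Lemma natr_eq0 n : (n%:R == 0 :> K) = (n == 0%N).
Proof. exact: (pcharf0P K).1. Qed.

Section Vanishing.
Variables (A : mexp I -> I -> I -> K) (HA : leibniz_coef A).
Hypothesis A1 : forall j k, j \in T -> k \in T -> A mone j k = 0.
Hypothesis AU : forall j, j \in T -> A (mexpU j) j j = 0.

Local Notation e := mexpU.

Lemma sum_mexpU j (c : I -> K) : j \in T -> \sum_(l <- T) (e j l)%:R * c l = c j.
Proof.
move=> jT; rewrite (big_fsetD1 j jT) /= mexpUE eqxx mul1r big_seq.
rewrite big1 ?addr0 // => l.
by rewrite in_fsetD1 mexpUE eq_sym => /andP[/negPf -> _]; rewrite mul0r.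
Qed.

(** The Leibniz rule for the commuting elements t^a d_j and t_i d_i. *)
Lemma coef_off_support a i j : mexp_in T a -> i \in T -> j \in T -> i != j ->
  a i = 0%N -> A a j i = 0.
Proof.
move=> aT iT jT ij ai; have eT : mexp_in T (e i) by rewrite mexp_inU.
have := HA aT eT jT iT iT; rewrite mexpUE (negPf ij) ai eqxx eq_sym (negPf ij) /=.
by rewrite !mul0r sum_mexpU // mul1r !subr0 sub0r opprK addr0 => <-.
Qed.

Lemma epow_in j n : j \in T -> mexp_in T (opow j n).
Proof.
move=> jT; elim: n => [|n IHn]; first exact: mexp_in1.
by rewrite [opow _ _]iterS mexp_inM mexp_inU jT.
Qed.

Lemma epowD j m n : mmul (opow j m) (opow j n) = opow j (m + n).
Proof. by apply/mexpP => i; rewrite mexpME !opowE; lia. Qed.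

Lemma sum_epow j n (c : I -> K) : j \in T ->
  \sum_(l <- T) (opow j n l)%:R * c l = n%:R * c j.
Proof.
move=> jT; rewrite -(sum_mexpU c jT) mulr_sumr; apply: eq_bigr => l _.
by rewrite mexpUE opowE natrM mulrA.
Qed.

Lemma coef_epowD j m n : j \in T -> m != n ->
  A (opow j (m + n)) j j = A (opow j m) j j + A (opow j n) j j.
Proof.
move=> jT mn; have := HA (epow_in m jT) (epow_in n jT) jT jT jT.
rewrite epowD !opowE eqxx !muln1 !sum_epow // !mul1r => eq_mn.
have nm : n%:R - m%:R != 0 :> K.
  by rewrite subr_eq0; apply: contra mn => /eqP /(natr_inj0 charK0) ->.
by apply: (mulfI nm); move: eq_mn; rewrite mulrBl => ->; ring.
Qed.

Lemma coef_epow1 j k : j \in T -> k \in T -> A (opow j 1) j k = 0.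
Proof.
move=> jT kT; have -> : opow j 1 = e j by rewrite [opow _ _]mulm1.
have [<-|jk] := eqVneq j k; first exact: AU.
by apply: coef_off_support; rewrite ?mexp_inU // 1?eq_sym // mexpUE (negPf jk).
Qed.

(** t_j d_j and t_j^2 d_j generate the t_j^m d_j with m >= 1, and there are two
    ways to reach t_j^5 d_j. *)
Lemma coef_epow2 j k : j \in T -> k \in T -> A (opow j 2) j k = 0.
Proof.
move=> jT kT; have [<-|jk] := eqVneq j k; last first.
  apply: coef_off_support; rewrite ?epow_in // 1?eq_sym //.
  by rewrite opowE (negPf jk) muln0.
have e1 := coef_epow1 jT jT.
have e3 : A (opow j 3) j j = A (opow j 2) j j.
  by rewrite (@coef_epowD j 1 2) // e1 add0r.
have e4 : A (opow j 4) j j = A (opow j 2) j j.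
  by rewrite (@coef_epowD j 1 3) // e1 e3 add0r.
have := @coef_epowD j 2 3 jT isT; rewrite (@coef_epowD j 1 4) // e1 e3 e4 add0r.
by move/eqP; rewrite -subr_eq subrr eq_sym => /eqP.
Qed.

(** As t_j d_j and t_j^2 d_j are killed, the derivation commutes with their adjoint
    actions; comparing the square of the first with the second yields the vanishing
    results below. *)
Lemma coef_epowM n b i j k : (n == 1%N) || (n == 2%N) ->
  mexp_in T b -> i \in T -> j \in T -> k \in T ->
  ((b j)%:R - n%:R * (j == i)%:R) * A (mmul (opow j n) b) i k =
  (b j)%:R * A b i k - n%:R * (j == k)%:R * A b i j.
Proof.
move=> n12 bT iT jT kT; have An l : l \in T -> A (opow j n) j l = 0.
  by case/orP: n12 => /eqP ->; [apply: coef_epow1 | apply: coef_epow2].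
have := HA (epow_in n jT) bT jT iT kT; rewrite An // sum_epow //.
rewrite big_seq big1 => [|l lT]; last by rewrite An // mulr0.
rewrite !mulr0 subr0 oppr0 add0r opowE natrM => eq_A.
transitivity ((b j)%:R * A (mmul (opow j n) b) i k -
              n%:R * (j == i)%:R * A (mmul (opow j n) b) j k); last first.
  by rewrite eq_A; ring.
by case: (j =P i) => [->|_] /=; ring.
Qed.

Lemma epow1M j b : mmul (opow j 1) b = mmul (e j) b.
Proof. by congr mmul; rewrite [opow _ _]mulm1. Qed.

Lemma epow2M j b : mmul (opow j 2) b = mmul (e j) (mmul (e j) b).
Proof.
rewrite mulmA; congr mmul; apply/mexpP => l.
by rewrite opowE mexpME mexpUE; lia.
Qed.

Lemma coef_off_diag b i j : mexp_in T b -> i \in T -> j \in T -> j != i ->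
  A b i j = 0.
Proof.
move=> bT iT jT ji.
have bT' : mexp_in T (mmul (e j) b) by rewrite mexp_inM mexp_inU jT.
have := coef_epowM isT bT iT jT jT (n := 1%N).
have := coef_epowM isT bT' iT jT jT (n := 1%N).
have := coef_epowM isT bT iT jT jT (n := 2%N).
rewrite epow2M !epow1M (negPf ji) eqxx mexpME mexpUE eqxx natrD.
move: (A (mmul (e j) (mmul _ _)) i j) (A (mmul _ b) i j) (A b i j) (b j)%:R.
move=> x y z m /=; rewrite !mulr0 !mulr1 !subr0 !mul1r => eq2 eq1' eq1.
have eq_z : (1 + m) * (m * z - 2 * z) = m * (m * z - z).
  rewrite -eq2 -eq1 mulrCA eq1'; ring.
apply/eqP; have /eqP : 2 * z = 0.
  by have /eqP := esym eq_z; rewrite -subr_eq0 => /eqP <-; ring.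
by rewrite mulf_eq0 natr_eq0.
Qed.

(** Only the diagonal coefficients remain; they are additive in the exponent,
    by the Leibniz rule, and insensitive to the exponent of t_i. *)
Lemma coef_diag_shift b i : mexp_in T b -> i \in T ->
  A (mmul (e i) b) i i = A b i i.
Proof.
move=> bT iT; have bT' : mexp_in T (mmul (e i) b) by rewrite mexp_inM mexp_inU iT.
have := coef_epowM isT bT iT iT iT (n := 1%N).
have := coef_epowM isT bT' iT iT iT (n := 1%N).
have := coef_epowM isT bT iT iT iT (n := 2%N).
rewrite epow2M !epow1M !eqxx mexpME mexpUE eqxx natrD /= -!mulrBl !mulr1.
have [->|bi] := eqVneq (b i) 1%N.
  have n1 : (1 - 2 : K) != 0.
    have -> : 1 - 2 = -1 :> K by ring.
    by rewrite oppr_eq0 oner_eq0.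
  by move=> /(mulfI n1) -> /=; rewrite addrK !mul1r => ->.
have bi1 : (b i)%:R - 1%:R != 0 :> K.
  by rewrite subr_eq0; apply: contra bi => /eqP /(natr_inj0 charK0) ->.
by move=> _ _ /(mulfI bi1).
Qed.

Lemma coef_diag_shift_off b i j : mexp_in T b -> i \in T -> j \in T -> j != i ->
  (0 < b j)%N -> A (mmul (e j) b) i i = A b i i.
Proof.
move=> bT iT jT ji bj; have := coef_epowM isT bT iT jT iT (n := 1%N).
rewrite epow1M (negPf ji) /= !mulr0 mul0r !subr0 => /mulfI; apply.
by rewrite natr_eq0 -lt0n.
Qed.

Lemma coef_diagD a b i : mexp_in T a -> mexp_in T b -> i \in T -> a i != b i ->
  A (mmul a b) i i = A a i i + A b i i.
Proof.
move=> aT bT iT ab; have := HA aT bT iT iT iT; rewrite eqxx /=.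
have sum_diag c d : mexp_in T d ->
    \sum_(l <- T) (c l : nat)%:R * A d i l = (c i)%:R * A d i i.
  move=> dT; rewrite (big_fsetD1 i iT) /= big_seq big1 ?addr0 // => l.
  by rewrite in_fsetD1 => /andP[li lT]; rewrite coef_off_diag ?mulr0.
rewrite !sum_diag // => eq_ab.
have ba : (b i)%:R - (a i)%:R != 0 :> K.
  by rewrite subr_eq0 eq_sym; apply: contra ab => /eqP /(natr_inj0 charK0) ->.
by apply: (mulfI ba); rewrite mulrBl eq_ab; ring.
Qed.

Lemma coef_diagU i j : i \in T -> j \in T -> A (e j) i i = 0.
Proof.
move=> iT jT; have [->|ji] := eqVneq j i; first exact: AU.
have [eiT ejT] : mexp_in T (e i) /\ mexp_in T (e j) by rewrite !mexp_inU.
have eijT : mexp_in T (mmul (e i) (e j)) by rewrite mexp_inM eiT.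
have := coef_diagD ejT eijT iT; rewrite mexpME !mexpUE eqxx (negPf ji).
move=> /(_ isT); rewrite coef_diag_shift // mulmA [mmul (e j) (e i)]mulmC -mulmA.
rewrite coef_diag_shift ?mexp_inM ?ejT //.
rewrite coef_diag_shift_off // ?mexpUE ?eqxx //.
by move/eqP; rewrite -subr_eq subrr eq_sym => /eqP.
Qed.

(** Induction on the exponent: each factor t_i is split off by additivity, after a
    shift in t_k which makes the exponents of t_k differ. *)
Lemma leibniz_coef_eq0 a j k : mexp_in T a -> j \in T -> k \in T -> A a j k = 0.
Proof.
move=> + jT kT; have [<-|kj] := eqVneq k j; last by move=> aT; apply: coef_off_diag.
move=> {jT}; elim/mexp_ind: a => [|i a IHa]; first by move=> _; apply: A1.
rewrite mexp_inM mexp_inU => /andP[iT aT].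
have [->|ik] := eqVneq i k; first by rewrite coef_diag_shift ?IHa.
have aT' : mexp_in T (mmul (e k) a) by rewrite mexp_inM mexp_inU kT.
have eiT : mexp_in T (e i) by rewrite mexp_inU.
rewrite -(coef_diag_shift _ kT) ?mexp_inM ?eiT // mulmA.
rewrite [mmul (e k) (e i)]mulmC -mulmA.
rewrite coef_diagD // ?coef_diagU ?coef_diag_shift ?IHa ?addr0 //.
by rewrite mexpME !mexpUE eqxx (negPf ik).
Qed.

End Vanishing.

End StructureConstants.

(** The coordinate on t^a d_k = t^a t_k d/dt_k, which has weight a for the torus. *)
HB.lock
Definition co (K : fieldType) (I : choiceType) (a : mexp I) (k : I)
    (v : Wplus K I) : K :=
  cf v k (mmul a (mexpU k)).

Section InnerDerivations.
Variables (K : fieldType) (charK0 : [pchar K] =i pred0).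
Variables (I : choiceType) (T : {fset I}).

Local Notation W := (Wplus K I).
Local Notation tau := (tdmon K).
Local Notation d := (tdmon K mone).
Local Notation e := mexpU.
Implicit Types (a b : mexp I) (i j k l : I) (u v w x y : W).

Local Notation co := (@co K I).

Lemma cf_tdmon a i k b : cf (tau a i) k b = ((mmul a (e i) == b) && (i == k))%:R.
Proof.
rewrite /cf Wcoef_tdmon malgMU mulr1 mcoeffMn mcoeffU -mulrnA mulnb.
by rewrite andbC.
Qed.

Lemma co0 a k : co a k 0 = 0. Proof. by rewrite co.unlock cf0. Qed.

Lemma coD a k v w : co a k (v + w) = co a k v + co a k w.
Proof. by rewrite co.unlock cfD. Qed.

Lemma coN a k v : co a k (- v) = - co a k v.
Proof. by rewrite co.unlock cfN. Qed.

Lemma coB a k v w : co a k (v - w) = co a k v - co a k w.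
Proof. by rewrite coD coN. Qed.

Lemma coZ a k c v : co a k (c *: v) = c * co a k v.
Proof. by rewrite co.unlock cfZ. Qed.

Lemma co_sum a k (J : Type) (s : seq J) (F : J -> W) :
  co a k (\sum_(j <- s) F j) = \sum_(j <- s) co a k (F j).
Proof. by rewrite co.unlock cf_sum. Qed.

Lemma co_tdmon a b i k : co a k (tau b i) = ((a == b) && (i == k))%:R.
Proof.
rewrite co.unlock cf_tdmon; case: (i =P k) => [->|_]; last by rewrite !andbF.
by rewrite ![mmul _ (e k)]mulmC (inj_eq (@mexp_mulI _ _)) eq_sym.
Qed.

(** The weight under d_i of the coordinate on t^a d/dt_k. *)
Definition wt i k a : int := (a i)%:Z - (i == k)%:Z.

Lemma cf_lie_d i v k a : cf (lie (d i) v) k a = (wt i k a)%:~R * cf v k a.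
Proof.
rewrite /cf [Wcoef (lie _ _) k]Wcoef_lie vact_tdmon mul1r Wcoef_tdmon mul1r.
rewrite linearMn /= vact_tvar mcoeffB mcoeff_euler mcoeffMn /wt intrB mulrBl.
rewrite -!pmulrn !mulr_natl; congr (_ - _); case: (i =P k) => [->//|_].
by rewrite !mulr0n.
Qed.

Lemma wt_mulU i k a : wt i k (mmul a (e k)) = (a i)%:Z.
Proof. by rewrite /wt mexpME mexpUE eq_sym PoszD addrK. Qed.

Lemma co_lie_d i v k a : co a k (lie (d i) v) = (a i)%:R * co a k v.
Proof. by rewrite co.unlock cf_lie_d wt_mulU -pmulrn. Qed.

(** A weight a with nonnegative entries only occurs on the t^a d_k, in contrast with
    the weights of the d/dt_k. *)
Lemma weight_space a v : mexp_in T a -> Win T v ->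
  (forall i, i \in T -> lie (d i) v = (a i)%:R *: v) ->
  v = \sum_(k <- T) co a k v *: tau a k.
Proof.
move=> aT vT vwt; apply: cfP => k b; rewrite cf_sum.
have [kT|kT] := boolP (k \in T); last first.
  rewrite (WinP T v).2 // ?(negPf kT) // big_seq big1 // => l lT.
  rewrite cfZ cf_tdmon; case: (l =P k) => [lk|_]; last by rewrite andbF mulr0.
  by rewrite -lk lT in kT.
rewrite (big_fsetD1 k kT) /= cfZ cf_tdmon eqxx andbT big_seq.
rewrite big1 => [|l]; last first.
  by rewrite in_fsetD1 cfZ cf_tdmon => /andP[/negPf -> _]; rewrite andbF mulr0.
rewrite addr0; case: eqP => [<-|/eqP ab]; first by rewrite mulr1 co.unlock.
rewrite mulr0; apply/eqP; apply: contraT => vkb; case/eqP: ab.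
have bT : mexp_in T b.
  by apply: contraNT vkb => bT; rewrite (WinP T v).2 // (negPf bT) andbF.
apply/mexpP => i; have [iT|iT] := boolP (i \in T); last first.
  rewrite (mexp_inP T b bT) // mexpME (mexp_inP T a aT) // mexpUE.
  by case: eqP kT iT => // -> ->.
have := congr1 (fun w => cf w k b) (vwt i iT); rewrite cf_lie_d cfZ => /(mulIf vkb).
rewrite /wt intrB -!pmulrn mexpME mexpUE [k == i]eq_sym => /eqP.
rewrite subr_eq -natrD => /eqP /(natr_inj0 charK0) ->; lia.
Qed.

Local Notation Wpp := (@Wplusplus_pred K I).

Definition Qpp v : Prop := v \in Wpp /\ Win T v.

Lemma Qpp_linear c x y : Qpp x -> Qpp y -> Qpp (c *: x + y).
Proof.
move=> [xP xT] [yP yT]; split; first by rewrite rpredD ?rpredZ.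
by apply: WinD yT; apply: WinZ.
Qed.

Lemma Qpp0 : Qpp 0. Proof. by split; [rewrite rpred0 | apply: Win0]. Qed.

Lemma QppZ c x : Qpp x -> Qpp (c *: x).
Proof. by move=> xQ; rewrite -[_ *: _]addr0; apply: Qpp_linear Qpp0. Qed.

Lemma QppD x y : Qpp x -> Qpp y -> Qpp (x + y).
Proof. by rewrite -{2}[x]scale1r; apply: Qpp_linear. Qed.

Lemma Qpp_tdmon a i : mexp_in T a -> i \in T -> Qpp (tau a i).
Proof. by move=> aT iT; split; [apply: tdmon_Wplusplus | apply: Win_tdmon]. Qed.

(** On W^{++}, the truncations of derivations of larger algebras are of this kind. *)
Definition is_der (D : W -> W) : Prop :=
  [/\ forall c x y, Qpp x -> Qpp y -> D (c *: x + y) = c *: D x + D y,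
      forall x y, Qpp x -> Qpp y -> D (lie x y) = lie (D x) y + lie x (D y)
    & forall x, Qpp x -> Win T (D x)].

Section FixedDerivation.
Variables (D : W -> W) (derD : is_der D).

Lemma der0 : D 0 = 0.
Proof.
case: derD => linD _ _; have := linD 1 0 0 Qpp0 Qpp0; rewrite !scale1r addr0.
by move/eqP; rewrite -subr_eq subrr => /eqP.
Qed.

Lemma der_add x y : Qpp x -> Qpp y -> D (x + y) = D x + D y.
Proof. by case: derD => linD _ _ xQ yQ; rewrite -{1}[x]scale1r linD ?scale1r. Qed.

Lemma derZ c x : Qpp x -> D (c *: x) = c *: D x.
Proof.
case: derD => linD _ _ xQ; rewrite -[c *: x]addr0 linD // ?der0 ?addr0 //.
exact: Qpp0.
Qed.

Lemma der_lie x y : Qpp x -> Qpp y -> D (lie x y) = lie (D x) y + lie x (D y).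
Proof. by case: derD => _ + _; apply. Qed.

Lemma der_Win x : Qpp x -> Win T (D x).
Proof. by case: derD => _ _; apply. Qed.

Lemma der_eq0 : (forall a i, mexp_in T a -> i \in T -> D (tau a i) = 0) ->
  forall x, Qpp x -> D x = 0.
Proof.
move=> D0 x [/Wplusplus_predP[s sx] xT]; rewrite -xT sx linear_sum /=.
pose Q y := Qpp y /\ D y = 0.
suff [] : Q (\sum_(z <- s) wtrunc T (z.1.1 *: tau z.1.2 z.2)) by [].
apply: (big_ind Q) => [|y z [yQ Dy] [zQ Dz]|[[c a] i] _ /=].
- by split; [apply: Qpp0 | apply: der0].
- by split; [apply: QppD | rewrite der_add // Dy Dz addr0].
rewrite linearZ /=; have [/andP[iT aT]|iaT] := boolP ((i \in T) && mexp_in T a).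
  have xQ := Qpp_tdmon aT iT; rewrite (xQ.2 : wtrunc T _ = _).
  by split; [apply: QppZ | rewrite derZ // D0 // scaler0].
suff -> : wtrunc T (tau a i) = 0.
  by rewrite scaler0; split; [apply: Qpp0 | apply: der0].
apply: cfP => k b; rewrite cf_wtrunc cf_tdmon cf0.
case: (mmul a (e i) =P b) => [<-|_]; last by rewrite mul0rn.
case: (i =P k) => [<-|_]; last by rewrite mul0rn.
rewrite mexp_inM mexp_inU; move: iaT.
by case: (i \in T); case: (mexp_in T a) => //=; rewrite mulr0n.
Qed.

End FixedDerivation.

Lemma der_sub_ad D u : is_der D -> Win T u -> is_der (fun x => D x - lie u x).
Proof.
case=> linD lieD DT uT; split=> [c x y xQ yQ|x y xQ yQ|x xQ].
- by rewrite linD // lieDr lieZr scalerBr opprD addrACA.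
- by rewrite lieD // lie_derivation lieBl lieBr opprD addrACA.
by apply: WinB; [apply: DT | apply: Win_lie xQ.2].
Qed.

Lemma Qpp_d i : i \in T -> Qpp (d i).
Proof. by move=> iT; apply: Qpp_tdmon; rewrite ?mexp_in1. Qed.

Lemma lie_dd i j : lie (d i) (d j) = 0.
Proof. by rewrite lie_tdmon !mexp1E !scale0r subr0. Qed.

Lemma lie_d_tdmon i a j : lie (d i) (tau a j) = (a i)%:R *: tau a j.
Proof. by rewrite lie_tdmon mexp1E mul1m scale0r subr0. Qed.

Lemma intr_eq0 (z : int) : (z%:~R == 0 :> K) = (z == 0).
Proof. by case: z => n; rewrite ?NegzE ?mulrNz ?oppr_eq0 -pmulrn natr_eq0. Qed.

(** The weight 0 part apart, the restriction of a derivation to the torus spanned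
    by the d_i is that of an inner derivation: dividing by the sum of the squares
    of the weights avoids the choice of a nonzero weight. *)
Lemma der_torus_inner D : is_der D -> exists u, Win T u /\
  forall i j, i \in T -> j \in T -> lie (d j) (D (d i) - lie u (d i)) = 0.
Proof.
move=> derD; pose N k a : int := \sum_(l <- T) wt l k a ^+ 2.
pose phi k a : K := - ((N k a)%:~R)^-1.
pose s := \sum_(l <- T) lie (d l) (D (d l)); exists (wdiag phi s); split.
  rewrite /Win [wtrunc T _]wdiagC; congr wdiag; rewrite -/(wtrunc T s).
  apply: Win_sum => l lT; apply: Win_lie; first exact: (Qpp_d lT).2.
  exact/(der_Win derD)/Qpp_d.
move=> i j iT jT; apply: cfP => k a.
rewrite cf_lie_d cf0 cfB [lie (wdiag _ _) _]lieC cfN opprK cf_lie_d cf_wdiag cf_sum.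
have swap l : l \in T ->
    (wt i k a)%:~R * cf (D (d l)) k a = (wt l k a)%:~R * cf (D (d i)) k a.
  move=> lT; have := der_lie derD (Qpp_d iT) (Qpp_d lT).
  rewrite lie_dd (der0 derD) lieC => /eqP.
  rewrite eq_sym addrC subr_eq0 => /eqP eq_il.
  by have := congr1 (fun w => cf w k a) eq_il; rewrite !cf_lie_d.
have -> : (wt i k a)%:~R * (phi k a * \sum_(l <- T) cf (lie (d l) (D (d l))) k a) =
    phi k a * (N k a)%:~R * cf (D (d i)) k a.
  rewrite mulrCA -mulrA; congr (_ * _).
  rewrite rmorph_sum mulr_sumr mulr_suml !big_seq.
  apply: eq_bigr => l lT; rewrite cf_lie_d mulrCA swap // mulrA.
  by rewrite rmorphXn.
have [N0|N0] := eqVneq (N k a) 0; last first.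
  by rewrite /phi mulNr mulVf ?intr_eq0 // mulN1r subrr mulr0.
suff -> : wt j k a = 0 by rewrite mul0r.
move/eqP: N0; rewrite /N Num.Theory.psumr_eq0 => [/allP/(_ j jT)|l _]; last first.
  exact: Num.Theory.sqr_ge0.
by rewrite /= sqrf_eq0 => /eqP.
Qed.

Lemma sum_tdmon_inner (c : I -> K) a j : j \in T ->
  lie (\sum_(l <- T) c l *: d l) (tau a j) =
  (\sum_(l <- T) c l * (a l)%:R) *: tau a j.
Proof.
move=> jT; rewrite lie_suml scaler_suml; apply: eq_bigr => l _.
by rewrite lieZl lie_d_tdmon scalerA.
Qed.

(** The Leibniz rule for d_i and t_l d_l, on the coordinate t_l d_l: the images of
    the t_l d_l drop out since both sides scale them by the same weight. *)
Lemma der_torus_eq0 D : is_der D ->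
  (forall i j, i \in T -> j \in T -> lie (d j) (D (d i)) = 0) ->
  forall i, i \in T -> D (d i) = 0.
Proof.
move=> derD D0 i iT; pose r l := co mone l (D (d i)).
have eqD : D (d i) = \sum_(l <- T) r l *: d l.
  apply: weight_space; rewrite ?mexp_in1 //; first exact/(der_Win derD)/Qpp_d.
  by move=> j jT; rewrite D0 // mexp1E scale0r.
rewrite eqD big_seq big1 // => l lT; suff -> : r l = 0 by rewrite scale0r.
have xQ : Qpp (tau (e l) l) by apply: Qpp_tdmon; rewrite ?mexp_inU.
have := der_lie derD (Qpp_d iT) xQ; rewrite lie_d_tdmon derZ //.
rewrite eqD sum_tdmon_inner // => /(congr1 (co (e l) l)).
rewrite coD !coZ co_lie_d co_tdmon !eqxx mulr1.
move/eqP; rewrite -subr_eq subrr eq_sym => /eqP.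
rewrite (big_fsetD1 l lT) /= mexpUE eqxx mulr1 big_seq big1 ?addr0 // => j.
by rewrite in_fsetD1 mexpUE eq_sym => /andP[/negPf -> _]; rewrite mulr0.
Qed.

Lemma co_lie_sum v (c : I -> K) a b i k :
  v = \sum_(l <- T) c l *: tau b l -> k \in T ->
  co (mmul a b) k (lie (tau a i) v) =
  (b i)%:R * c k - (i == k)%:R * \sum_(l <- T) (a l)%:R * c l.
Proof.
move=> -> kT; rewrite lie_sumr co_sum mulr_sumr.
transitivity (\sum_(l <- T) (c l * ((b i)%:R * (l == k)%:R) -
                             (i == k)%:R * ((a l)%:R * c l))).
  apply: eq_bigr => l _; rewrite lieZr lie_tdmon coZ coB !coZ.
  by rewrite !co_tdmon !eqxx /=; ring.
rewrite big_split /= sumrN; congr (_ - _).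
rewrite (big_fsetD1 k kT) /= eqxx mulr1 big_seq big1 ?addr0 ?[_ * c k]mulrC // => l.
by rewrite in_fsetD1 => /andP[/negPf -> _]; rewrite !mulr0.
Qed.

Section KillsTorus.
Variables (D : W -> W) (derD : is_der D).
Hypothesis D0 : forall i, i \in T -> D (d i) = 0.

Lemma der_tdmon a j : mexp_in T a -> j \in T ->
  D (tau a j) = \sum_(k <- T) co a k (D (tau a j)) *: tau a k.
Proof.
move=> aT jT; have xQ := Qpp_tdmon aT jT.
apply: weight_space => //; first exact: der_Win.
move=> i iT; have := der_lie derD (Qpp_d iT) xQ.
by rewrite D0 // lie0l add0r lie_d_tdmon derZ.
Qed.

Lemma der_leibniz_coef : leibniz_coef T (fun a j k => co a k (D (tau a j))).
Proof.
move=> a b i j k aT bT iT jT kT.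
have [xQ yQ] := (Qpp_tdmon aT iT, Qpp_tdmon bT jT).
have abT : mexp_in T (mmul a b) by rewrite mexp_inM aT.
have [abiQ abjQ] := (Qpp_tdmon abT iT, Qpp_tdmon abT jT).
transitivity (co (mmul a b) k (D (lie (tau a i) (tau b j)))).
  rewrite lie_tdmon -scaleNr (der_add derD (QppZ _ abjQ) (QppZ _ abiQ)).
  by rewrite (derZ derD _ abiQ) (derZ derD _ abjQ) coD !coZ mulNr.
rewrite (der_lie derD xQ yQ) coD (lieC (D _)) coN; congr (- _ + _).
  by rewrite mulmC; apply: co_lie_sum (der_tdmon aT iT) kT.
exact: co_lie_sum (der_tdmon bT jT) kT.
Qed.

End KillsTorus.

(** Inner derivations successively kill the torus and the coefficients of the
    t_l d_l; what remains vanishes by [leibniz_coef_eq0]. *)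
Theorem der_inner D : is_der D ->
  exists u, Win T u /\ forall x, Qpp x -> D x = lie u x.
Proof.
move=> derD; have [u1 [u1T torus1]] := der_torus_inner derD.
have derD1 := der_sub_ad derD u1T; pose D1 x := D x - lie u1 x.
have D1d := der_torus_eq0 derD1 torus1.
pose u2 := \sum_(l <- T) co (e l) l (D1 (tau (e l) l)) *: d l.
have u2T : Win T u2.
  by apply: Win_sum => l lT; apply: WinZ; apply: (Qpp_d lT).2.
have derD2 := der_sub_ad derD1 u2T; pose D2 x := D1 x - lie u2 x.
have D2d i : i \in T -> D2 (d i) = 0.
  move=> iT; rewrite /D2 [D1 _]D1d // sum_tdmon_inner //.
  rewrite big1 ?scale0r ?subr0 // => l _.
  by rewrite mexp1E mulr0.
exists (u1 + u2); split; first exact: WinD.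
suff D20 x : Qpp x -> D2 x = 0.
  move=> x /D20 /eqP; rewrite /D2 /D1 -addrA -opprD -lieDl subr_eq0.
  by move/eqP.
apply: (der_eq0 derD2) => a i aT iT.
apply: (etrans (der_tdmon derD2 D2d aT iT)); rewrite big_seq big1 // => k kT.
suff -> : co a k (D2 (tau a i)) = 0 by rewrite scale0r.
have coefA := der_leibniz_coef derD2 D2d.
apply: (leibniz_coef_eq0 charK0 coefA) => // [j l jT lT|j jT].
  by rewrite [X in co _ _ X]D2d // co0.
rewrite coB sum_tdmon_inner // coZ co_tdmon !eqxx mulr1.
apply/eqP; rewrite subr_eq0; apply/eqP.
apply: (etrans (esym (sum_mexpU (fun l => co (e l) l (D1 (tau (e l) l))) jT))).
by apply: eq_bigr => l _; rewrite mulrC.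
Qed.

End InnerDerivations.

(** * From W^{++} to the algebras between W^{++} and W^+ *)

HB.lock
Definition wmon (K : fieldType) (I : choiceType) (p : polyIn K I) (k : I) :
    Wplus K I :=
  << p *g k >>.

Section TangentFields.
Variables (K : fieldType) (I : choiceType).

Local Notation P := (polyIn K I).
Local Notation W := (Wplus K I).
Local Notation Wpp := (@Wplusplus_pred K I).
Local Notation tau := (tdmon K).
Local Notation t := (tvar K).
Local Notation e := mexpU.
Implicit Types (p q : P) (a b : mexp I) (i j k : I) (u v w : W) (T : {fset I}).

Lemma Wcoef_wmon p i k : Wcoef (wmon p i) k = p *+ (i == k).
Proof. by rewrite wmon.unlock Wcoef.unlock; apply: mcoeffU. Qed.

Lemma wmon_Wpp q k : wmon (t k * q) k \in Wpp.
Proof.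
elim/poly_ind_monom: q => [|p q IHp IHq|c a].
- suff -> : wmon (t k * 0) k = 0 by apply: rpred0.
  by apply/WplusP => i; rewrite Wcoef_wmon Wcoef0 mulr0 mul0rn.
- suff -> : wmon (t k * (p + q)) k = wmon (t k * p) k + wmon (t k * q) k.
    exact: rpredD IHp IHq.
  by apply/WplusP => i; rewrite WcoefD !Wcoef_wmon mulrDr mulrnDl.
suff -> : wmon (t k * << c *g a >>) k = c *: tau a k.
  exact: rpredZ (tdmon_Wplusplus _ _ _).
apply/WplusP => i; rewrite WcoefZ Wcoef_wmon Wcoef_tdmon.
rewrite -[<< c *g a >>]mulr1 -[c in << c *g _ >>]mulr1 -malgZU -scalerAl -scalerAr.
by rewrite mulr1 [t k * _]mulrC scalerMnr.
Qed.

(** In other words, W^{++} consists of the vector fields tangent to the coordinate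
    hyperplanes. *)
Lemma Wpp_dvd v : (forall k, exists q, Wcoef v k = t k * q) -> v \in Wpp.
Proof.
move=> v_dvd; have -> : v = \sum_(k <- msupp v) wmon (Wcoef v k) k.
  by rewrite wmon.unlock Wcoef.unlock; apply: (@monalgE I P v).
by apply: rpred_sum => k _; have [q ->] := v_dvd k; apply: wmon_Wpp.
Qed.

Lemma dvd_monom a k : (0 < a k)%N -> << a >> = t k * << mexp_pred k a >> :> P.
Proof. by move=> ak; rewrite malgMU mulr1 mexp_predK. Qed.

Lemma exists_full_monom T : exists s : mexp I,
  mexp_in T s /\ forall k, k \in T -> (0 < s k)%N.
Proof.
exists (\big[mmul/mone]_(k <- T) e k); split.
  rewrite big_seq; apply: (big_ind (mexp_in T)) => [|a b aT bT|k kT].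
  - exact: mexp_in1.
  - by rewrite mexp_inM aT.
  - by rewrite mexp_inU.
by move=> k kT; rewrite (big_fsetD1 k kT) [X in (_ < X)%N]mexpME mexpUE eqxx.
Qed.

(** If all the variables divide t^s, they divide the coefficients of the bracket: an
    arbitrary vector field is brought into W^{++} by a bracket. *)
Lemma lie_tdmon_Wpp T (s : mexp I) j v :
  Win T v -> (forall k, k \in T -> (0 < s k)%N) -> j \in T ->
  lie (tau s j) v \in Wpp.
Proof.
move=> vT sT jT; apply: Wpp_dvd => k; rewrite Wcoef_lie Wcoef_tdmon vact_tdmon.
have [kT|kT] := boolP (k \in T); last first.
  have -> : (j == k) = false by apply: contraNF kT => /eqP <-.
  by exists 0; rewrite (Win_out vT kT) mulr0n !linear0 !mulr0 addr0.
have [<-|_] := eqVneq j k; last first.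
  rewrite mulr0n linear0 subr0 (dvd_monom (sT k kT)).
  by eexists; rewrite -!mulrA; reflexivity.
rewrite mulr1n vactM vact_tvar (dvd_monom (sT j jT)).
exists (<< mexp_pred j s >> * t j * pderiv j (Wcoef v j)
  - (vact v (t j * << mexp_pred j s >>) + << mexp_pred j s >> * Wcoef v j)).
by ring.
Qed.

(** Subtracting t_j times the first relation from the second leaves t^s t_j v_j. *)
Lemma commutant_tangent_eq0 T (s : mexp I) v : Win T v ->
  (forall j, j \in T -> lie (tau s j) v = 0) ->
  (forall j, j \in T -> lie (tau (mmul (e j) s) j) v = 0) -> v = 0.
Proof.
move=> vT comm1 comm2; apply/WplusP => j; rewrite Wcoef0.
have [jT|jT] := boolP (j \in T); last exact: Win_out vT jT.
have coefj b : lie (tau b j) v = 0 ->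
    << b >> * t j * pderiv j (Wcoef v j) = vact v (<< b >> * t j).
  move=> comm_b; have := Wcoef_lie (tau b j) v j.
  rewrite [Wplus_lie _ _]comm_b Wcoef0 vact_tdmon Wcoef_tdmon eqxx mulr1n => /eqP.
  by rewrite eq_sym subr_eq0 => /eqP.
have eq1 := coefj _ (comm1 j jT); have := coefj _ (comm2 j jT).
have -> : << mmul (e j) s >> = t j * << s >> :> P by rewrite malgMU mulr1.
rewrite -[t j * _ * t j]mulrA vactM vact_tvar -eq1 => eq2.
apply: (@monomMI K I (mmul s (e j))); rewrite mulr0.
have -> : << mmul s (e j) >> = << s >> * t j :> P by rewrite malgMU mulr1.
by move: eq2 => /eqP; rewrite -subr_eq0 => /eqP eq2; rewrite -oppr0 -eq2; ring.
Qed.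

Lemma Win_exists_seq (s : seq W) (o : I) :
  exists T, o \in T /\ forall n, (n < size s)%N -> Win T s`_n.
Proof.
elim: s => [|w s [T [oT sT]]]; first by exists [fset o]; rewrite in_fset1 eqxx.
have [T' wT'] := Win_exists w; exists (T `|` T'); rewrite in_fsetU oT.
split=> // -[|n] /=; first by move=> _; apply: Win_sub (fsubsetUr _ _) wT'.
by rewrite ltnS => /sT; apply: Win_sub (fsubsetUl _ _).
Qed.

End TangentFields.

(** A Lie algebra [L] between W^{++} and W^+, given by its embedding [iota] and a
    section [kap] of [iota] over W^{++}: this covers both algebras at once. *)
Section BetweenDerivations.
Variables (K : fieldType) (charK0 : [pchar K] =i pred0) (I : choiceType).

Local Notation W := (Wplus K I).
Local Notation Wpp := (@Wplusplus_pred K I).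
Implicit Types (u v w : W) (T : {fset I}) (f g : {poly K}).

Variables (L : lieAlgType K) (iota : L -> W) (kap : W -> L).
Hypotheses (iota_lin : linear iota) (iota_inj : injective iota).
Hypothesis iota_lie : forall x y, iota (lie x y) = lie (iota x) (iota y).
Hypothesis kapK : {in Wpp, cancel kap iota}.
Implicit Types (x y z : L).

Lemma iotaD x y : iota (x + y) = iota x + iota y.
Proof. by have := iota_lin 1 x y; rewrite !scale1r. Qed.

(** On W^{++} the truncated derivation is the bracket with some [u]. For any x, the
    difference y of its value at x and of [u, x] then commutes with the elements of
    W^{++} whose bracket with x is in W^{++}, by the Leibniz rule, and there are
    enough of them to force y = 0. *)
Lemma der_between_inner T (D : L -> L) : is_derivation D ->
  exists u, Win T u /\
    forall x, Win T (iota x) -> wtrunc T (iota (D x)) = lie u (iota x).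
Proof.
case=> linD lieD; pose D' v := wtrunc T (iota (D (kap v))).
have leibniz x y : Win T (iota x) -> Win T (iota y) ->
    wtrunc T (iota (D (lie x y))) =
    lie (wtrunc T (iota (D x))) (iota y) + lie (iota x) (wtrunc T (iota (D y))).
  move=> xT yT; rewrite lieD iotaD !iota_lie linearD /= wtrunc_lie //.
  by rewrite (lieC (iota x)) linearN /= wtrunc_lie // -lieC.
have derD' : is_der T D'.
  split=> [c v w [vP vT] [wP wT]|v w [vP vT] [wP wT]|v _]; last exact: wtruncK.
    have -> : D' (c *: v + w) = wtrunc T (iota (D (c *: kap v + kap w))).
      congr (wtrunc T (iota (D _))); apply: iota_inj.
      by rewrite iota_lin !kapK // rpredD ?rpredZ.
    by rewrite linD iota_lin linearP.
  have -> : D' (lie v w) = wtrunc T (iota (D (lie (kap v) (kap w)))).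
    congr (wtrunc T (iota (D _))); apply: iota_inj.
    by rewrite iota_lie !kapK // Wplusplus_lie.
  by rewrite leibniz ?kapK.
have [u [uT D'u]] := der_inner charK0 derD'; exists u; split=> // x xT.
pose y := wtrunc T (iota (D x)) - lie u (iota x).
have yT : Win T y by apply: WinB; [apply: wtruncK | apply: Win_lie].
suff : y = 0 by move/eqP; rewrite subr_eq0 => /eqP.
have [s [sT s0]] := exists_full_monom T.
have comm b j : mexp_in T b -> (forall k, k \in T -> (0 < b k)%N) -> j \in T ->
    lie (tdmon K b j) y = 0.
  move=> bT b0 jT; have gQ := Qpp_tdmon K bT jT; set g := tdmon K b j in gQ *.
  have gxP : lie g (iota x) \in Wpp := lie_tdmon_Wpp xT b0 jT.
  have := D'u _ (conj gxP (Win_lie gQ.2 xT)).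
  have -> : D' (lie g (iota x)) = wtrunc T (iota (D (lie (kap g) x))).
    congr (wtrunc T (iota (D _))); apply: iota_inj.
    by rewrite iota_lie !kapK // gQ.1.
  rewrite leibniz ?kapK ?gQ.1 //; last exact: gQ.2.
  rewrite -/(D' g) D'u // lie_derivation => /addrI eq_g.
  by rewrite /y lieBr eq_g subrr.
apply: (commutant_tangent_eq0 yT (s := s)) => j jT; apply: comm => // [|k kT].
  by rewrite mexp_inM mexp_inU jT.
by rewrite mexpME addn_gt0 s0 ?orbT.
Qed.

(** * 2-local derivations *)

Lemma Xf_Wpp T o f : Xf T o f \in Wpp.
Proof.
apply: Wpp_dvd => k; rewrite Wcoef_Xf; case: ifP => _; last first.
  by exists 0; rewrite mulr0.
rewrite /Ecoef; case: eqP => [->|_]; last first.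
  by exists (emb o f * (emb o 'X^(ew T k) + tvar K k)); ring.
by exists (emb o f * tvar K o); rewrite embM embX; ring.
Qed.

(** After subtraction of an inner derivation, [F] kills X 1 and X 'X, the fields E
    and t_o E. Its value at z is then a multiple c of [E, z], and a multiple c' of
    [t_o E, z]. If it is not 0, then z commutes with (c - c' t_o) E, hence is
    proportional to it. This excludes t_o^2 E, so that [F] also kills this third
    field. So the value is a multiple of [t_o^2 E, z] as well, whereas for a multiple
    z of (c - c' t_o) E the brackets [E, z] and [t_o^2 E, z] have no common nonzero
    multiple. *)
Lemma local_inner T o (F : L -> W) : o \in T ->
  (forall x y, Win T (iota x) -> Win T (iota y) -> exists u,
     [/\ Win T u, F x = lie u (iota x) & F y = lie u (iota y)]) ->
  exists u, Win T u /\ forall x, Win T (iota x) -> F x = lie u (iota x).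
Proof.
move=> oT HF; pose X (f : {poly K}) := Xf T o f; pose xf f := kap (X f).
have xfE f : iota (xf f) = X f by rewrite kapK // Xf_Wpp.
have xfT f : Win T (iota (xf f)) by rewrite xfE; apply: Win_Xf.
have [u [uT F1 FX]] := HF _ _ (xfT 1) (xfT 'X); exists u; split=> // z zT.
pose G x := F x - lie u (iota x).
have local_G f x : f != 0 -> G (xf f) = 0 -> Win T (iota x) ->
    exists c, G x = c *: lie (X f) (iota x).
  move=> f0 Gf xT; have [w [wT Ff Fx]] := HF _ _ (xfT f) xT.
  have [||c eq_wu] := centralizer_Xf charK0 oT (u := w - u) f0.
  - exact: WinB.
  - by move/eqP: Gf; rewrite /G Ff -lieBl xfE lieC oppr_eq0 => /eqP.
  by exists c; rewrite /G Fx -lieBl eq_wu lieZl.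
have G1 : G (xf 1) = 0 by rewrite /G F1 subrr.
have GX : G (xf 'X) = 0 by rewrite /G FX subrr.
have X0 : 'X != 0 :> {poly K} by rewrite polyX_eq0.
have dich x : Win T (iota x) -> G x = 0 \/
    exists c c' nu, [/\ c != 0, iota x = nu *: X (c%:P - c' *: 'X)
      & G x = c *: lie (X 1) (iota x)].
  move=> xT; have [c Gc] := local_G 1 x (oner_neq0 _) G1 xT.
  have [c' Gc'] := local_G 'X x X0 GX xT.
  have [c0|c0] := eqVneq c 0; first by left; rewrite Gc c0 scale0r.
  right; exists c, c'; set f := _ - _.
  have f0 : f != 0.
    apply: contra c0 => /eqP/(congr1 (fun p : {poly K} => p`_0)).
    by rewrite coefB coefC coefZ coefX mulr0 subr0 coef0 => ->.
  have comm : lie (X f) (iota x) = 0.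
    have -> : X f = c *: X 1 - c' *: X 'X.
      by rewrite /X -scaleN1r -!XfZ -XfD scaleN1r alg_polyC.
    by rewrite lieBl !lieZl -Gc -Gc' subrr.
  have [nu eq_x] := centralizer_Xf charK0 oT f0 xT comm.
  by exists nu.
have X20 : 'X^2 != 0 :> {poly K} by rewrite -size_poly_eq0 size_polyXn.
(* c - c' t_o has degree at most 1. *)
have GX2 : G (xf 'X^2) = 0.
  have [//|[c [c' [nu [c0]]]]] := dich _ (xfT 'X^2).
  rewrite xfE /X -XfZ => /(Xf_inj oT) eq_X2 _; exfalso.
  have := congr1 (fun p : {poly K} => p`_2) eq_X2.
  rewrite coefXn coefZ coefB coefC coefZ coefX /= mulr0 subr0 mulr0 => /eqP.
  by rewrite oner_eq0.
have [/eqP|[c [c' [nu [c0 eq_z Gz]]]]] := dich z zT.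
  by rewrite subr_eq0 => /eqP.
have [r Gr] := local_G 'X^2 z X20 GX2 zT.
have nu_r : r * nu = 0.
  set f := _ - _ in eq_z; have df : f^`() = (- c')%:P.
    by rewrite /f derivB derivC derivZ derivX sub0r -mul_polyC mulr1 polyCN.
  move: Gr; rewrite Gz eq_z !lieZr /X !lie_Xf // -!XfZ => /(Xf_inj oT).
  rewrite df derivXn derivC mulr0 subr0 mul1r /= expr1 => eq_X.
  have {}eq_X : (- c * nu * c') *: 'X^2 =
      (r * nu) *: (c' *: 'X^4 - (2 * c) *: 'X^3).
    have -> : (- c * nu * c') *: 'X^2 = c *: (nu *: ('X^2 * (- c')%:P)).
      by rewrite -!mul_polyC !polyCM !polyCN; ring.
    rewrite eq_X /f -!mul_polyC !polyCM !polyCN; ring.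
  (* The bracket with E only contributes in degree 2. *)
  have := congr1 (fun p : {poly K} => p`_3) eq_X.
  rewrite !(coefZ, coefB, coefXn) /= !mulr0 mulr1 sub0r => /esym/eqP.
  rewrite mulf_eq0 oppr_eq0 [2 * c == 0]mulf_eq0 (negPf c0) natr_eq0 // !orbF.
  by move/eqP.
move: Gr; rewrite eq_z lieZr scalerA nu_r scale0r => /eqP.
by rewrite subr_eq0 eq_z => /eqP.
Qed.

(** Being a derivation only involves finitely many elements, and they all lie in
    finitely many variables together with their images. *)
Theorem local_der_between (o : I) (Delta : L -> L) :
  is_2local_derivation Delta -> is_derivation Delta.
Proof.
move=> Delta2; pose F T x := wtrunc T (iota (Delta x)).
have inner T : o \in T -> exists u, Win T u /\
    forall x, Win T (iota x) -> F T x = lie u (iota x).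
  move=> oT; apply: (local_inner oT) => x y xT yT.
  have [D [derD Dx Dy]] := Delta2 x y; have [u [uT Du]] := der_between_inner T derD.
  by exists u; rewrite /F Dx Dy !Du.
have FE T z : Win T (iota (Delta z)) -> iota (Delta z) = F T z.
  by move=> zT; rewrite /F zT.
split=> [c x y|x y]; apply: iota_inj.
  have [T [oT sT]] := Win_exists_seq
    [:: iota x; iota y; iota (Delta x); iota (Delta y);
        iota (Delta (c *: x + y))] o.
  have [u [uT Fu]] := inner T oT.
  have [xT yT] : Win T (iota x) /\ Win T (iota y) := conj (sT 0%N isT) (sT 1%N isT).
  rewrite iota_lin.
  rewrite (FE _ _ (sT 2%N isT)) (FE _ _ (sT 3%N isT)) (FE _ _ (sT 4%N isT)).
  rewrite (Fu _ xT) (Fu _ yT) Fu iota_lin ?lieDr ?lieZr //.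
  by apply: WinD yT; apply: WinZ.
have [T [oT sT]] := Win_exists_seq
  [:: iota x; iota y; iota (Delta x); iota (Delta y); iota (Delta (lie x y))] o.
have [u [uT Fu]] := inner T oT.
have [xT yT] : Win T (iota x) /\ Win T (iota y) := conj (sT 0%N isT) (sT 1%N isT).
rewrite iotaD !iota_lie.
rewrite (FE _ _ (sT 2%N isT)) (FE _ _ (sT 3%N isT)) (FE _ _ (sT 4%N isT)).
rewrite (Fu _ xT) (Fu _ yT) Fu; last by rewrite iota_lie; apply: Win_lie.
by rewrite iota_lie; apply: lie_derivation.
Qed.

End BetweenDerivations.

Theorem theorem5p1 (R : realType) (n : option nat) (n_neq0 : n <> Some 0%N) :
  (forall Delta : Wplus R[i] (var_index n) -> Wplus R[i] (var_index n),
     is_2local_derivation Delta -> is_derivation Delta) /\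
  (forall Delta : Wplusplus R[i] (var_index n) -> Wplusplus R[i] (var_index n),
     is_2local_derivation Delta -> is_derivation Delta).
Proof.
have o : var_index n.
  case: n n_neq0 => [[|m]|] //= _; [exact: ord0 | exact: 0%N].
split=> Delta.
  by apply: (@local_der_between R[i] (Num.Theory.pchar_num _) _ _ id id).
apply: (@local_der_between R[i] (Num.Theory.pchar_num _) _ _ (@Wpp_val _ _)
  (insubd 0)) => //; first exact: val_inj.
by move=> v vP; apply: insubdK.
Qed.
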